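(* Let $\sigma=0$ and let $(\mathbf U^k,P^k,\mathbf W^k,\mathbf M^k,\Phi^k)_{k=1}^K\subset\mathbb U\times\mathbb P\times\mathbb W\times\mathbb M\times\mathbb X$ be a solution of the discrete scheme described in the context, with $\mathbf H^k=\nabla\Phi^k$. Assume $\nabla\mathbb X\subset\mathbb M$, that the pair $(\mathbb U,\mathbb P)$ is LBB stable, and that $b_h$ and $b_h^m$ are skew-symmetric in their last two arguments. Then $$\mathscr E^K+\sum_{k=1}^K\mathscr I^k+\sum_{k=1}^K\tau\,\mathscr D^k\le\sum_{k=1}^K\tau\,\mathscr F^k+\mathscr E^0,$$ where, with all norms being $L^2(\Omega)$ norms, $$\mathscr E^k=\tfrac12\big(\|\mathbf U^k\|^2+\jmath\|\mathbf W^k\|^2+\mu_0\|\mathbf M^k\|^2+\mu_0\|\mathbf H^k\|^2\big),$$ $$\mathscr I^k=\tfrac12\big(\|\delta\mathbf U^k\|^2+\jmath\|\delta\mathbf W^k\|^2+\mu_0\|\delta\mathbf M^k\|^2+\mu_0\|\delta\mathbf H^k\|^2\big),$$ $$\begin{aligned}\mathscr D^k=\;&\nu\|\nabla\mathbf U^k\|^2+c_1\|\nabla\mathbf W^k\|^2+\nu_r\|\operatorname{div}\mathbf U^k\|^2+c_2\|\operatorname{div}\mathbf W^k\|^2+\nu_r\|\operatorname{curl}\mathbf U^k-2\mathbf W^k\|^2\\&+\tfrac{\mu_0}{\mathscr T}\|\mathbf M^k\|^2+\tfrac{\mu_0}{2\mathscr T}\big(\tfrac12+3\varkappa_0\big)\|\mathbf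 H^k\|^2,\end{aligned}$$ $$\mathscr F^k=\frac{\mathscr T\mu_0}{\tau}\int_{t^{k-1}}^{t^k}\|\partial_t\mathbf h_a(s)\|^2ds+\frac{\mu_0}{2\mathscr T}(1+\varkappa_0)\|\mathbf h_a^k\|^2 .$$
   Context: $\Omega\subset\mathbb R^3$ is a bounded simply connected convex polyhedron. The material constants $\nu,\nu_r,\mu_0,\jmath,c_1,c_2,\varkappa_0$ are nonnegative, $\mathscr T>0$, and $\nu_0:=\nu+\nu_r$. $\mathbf h_a$ is a given smooth vector field on $\overline\Omega\times[0,t_F]$ with $\operatorname{curl}\mathbf h_a=0$, $\operatorname{div}\mathbf h_a=0$. $K\ge1$ is the number of time steps, $\tau=t_F/K$, $t^k=k\tau$, $\mathbf h_a^k=\mathbf h_a(\cdot,t^k)$, and $\delta\varrho^k=\varrho^k-\varrho^{k-1}$. $(\cdot,\cdot)$ is the $L^2(\Omega)$ inner product. Finite dimensional spaces: $\mathbb U,\mathbb W\subset \mathbf H^1_0(\Omega)$, $\mathbb P\subset L^2(\Omega)$, $\mathbb M\subset \mathbf L^2(\Omega)$, $\mathbb X\subset H^1(\Omega)$ (bold: $\mathbb R^3$-valued). LBB stability: there is $\beta^*>0$ independent of the discretization parameter $h$ with $\sup_{0\ne\mathbf V\in\mathbb U}\frac{(\operatorname{div}\mathbf V,Q)}{\|\nabla\mathbf V\|_{L^2}}\ge\beta^*\|Q\|_{L^2}$ for all $Q\in\mathbb P$ with zero mean. Trilinear forms: $b_h:\mathbb U\times(\mathbb U+\mathbb W)\times(\mathbb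 U+\mathbb W)\to\mathbb R$ and $b_h^m:\mathbb U\times\mathbb M\times\mathbb M\to\mathbb R$. Skew-symmetry means $b_h(\mathbf U,\mathbf V,\mathbf W)=-b_h(\mathbf U,\mathbf W,\mathbf V)$ and $b_h^m(\mathbf U,\mathbf V,\mathbf W)=-b_h^m(\mathbf U,\mathbf W,\mathbf V)$ for all admissible arguments. Scheme (case $\sigma=0$): $\mathbf U^0\in\mathbb U$, $\mathbf W^0\in\mathbb W$, $\mathbf M^0\in\mathbb M$ are given (interpolants of the smooth initial data $\mathbf u_0,\mathbf w_0,\mathbf m_0$), and $\Phi^0\in\mathbb X$, $\mathbf H^0=\nabla\Phi^0$, is defined by the last equation below with $k=0$. For $k=1,\dots,K$, $(\mathbf U^k,P^k,\mathbf W^k,\mathbf M^k,\Phi^k)\in\mathbb U\times\mathbb P\times\mathbb W\times\mathbb M\times\mathbb X$ satisfies, with $\mathbf H^k=\nabla\Phi^k$, $$\big(\tfrac{\delta\mathbf U^k}{\tau},\mathbf V\big)+b_h(\mathbf U^k,\mathbf U^k,\mathbf V)+\nu_0(\nabla\mathbf U^k,\nabla\mathbf V)-(P^k,\operatorname{div}\mathbf V)=2\nu_r(\operatorname{curl}\mathbf W^k,\mathbf V)+\mu_0b_h^m(\mathbf V,\mathbf H^k,\mathbf M^k),$$ $$(Q,\operatorname{div}\mathbf U^k)=0,$$ $$\jmath\big(\tfrac{\delta\mathbf W^k}{\tau},\mathbf X\big)+\jmath b_h(\mathbf U^k,\mathbf W^k,\mathbf X)+c_1(\nabla\mathbf W^k,\nabla\mathbf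 X)+c_2(\operatorname{div}\mathbf W^k,\operatorname{div}\mathbf X)+4\nu_r(\mathbf W^k,\mathbf X)=2\nu_r(\operatorname{curl}\mathbf U^k,\mathbf X)+\mu_0(\mathbf M^k\times\mathbf H^k,\mathbf X),$$ $$\big(\tfrac{\delta\mathbf M^k}{\tau},\mathbf Z\big)-b_h^m(\mathbf U^k,\mathbf Z,\mathbf M^k)+(\mathbf M^k\times\mathbf W^k,\mathbf Z)+\tfrac1{\mathscr T}(\mathbf M^k,\mathbf Z)=\tfrac{\varkappa_0}{\mathscr T}(\mathbf H^k,\mathbf Z),$$ $$(\nabla\Phi^k,\nabla\chi)=(\mathbf h_a^k-\mathbf M^k,\nabla\chi),$$ for all $\mathbf V\in\mathbb U$, $Q\in\mathbb P$, $\mathbf X\in\mathbb W$, $\mathbf Z\in\mathbb M$, $\chi\in\mathbb X$. *)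

(* Defs.v *)
From HB Require Import structures.
From mathcomp Require Import all_boot all_order all_algebra.
From mathcomp Require Import all_classical all_reals all_analysis.

Set Implicit Arguments.
Unset Strict Implicit.
Unset Printing Implicit Defensive.

Import Order.TTheory GRing.Theory Num.Theory.
Import numFieldNormedType.Exports.

Local Open Scope classical_set_scope.
Local Open Scope ring_scope.

(* Points of R^3 are triples, because products of realTypes carry both the
   Borel sigma-algebra and the (normed) topology used below; the values of
   vector fields are row vectors. *)
Notation pt R := (R * R * R)%type.

Definition leb3 (R : realType) :
  {measure set (measurableTypeR R * measurableTypeR R * measurableTypeR R)
   -> \bar R} :=
  (lebesgue_measure \x lebesgue_measure \x lebesgue_measure)%E.

Definition axis (R : realType) (j : 'I_3) : pt R :=
  ((j == 0)%:R, (j == 1)%:R, (j == 2%:R)%:R).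

Definition pdot (R : realType) (a x : pt R) : R :=
  a.1.1 * x.1.1 + a.1.2 * x.1.2 + a.2 * x.2.

Definition convex_polyhedron (R : realType) (Omega : set (pt R)) : Prop :=
  exists n (a : 'I_n -> pt R) (b : 'I_n -> R),
    (forall i, a i != 0) /\ Omega = [set x | forall i, pdot (a i) x < b i].

Definition simply_connected (R : realType) (A : set (pt R)) : Prop :=
  (forall x y, A x -> A y -> exists g : R -> pt R,
     [/\ {within `[0, 1]%classic, continuous g}, g @` `[0, 1]%classic `<=` A, g 0 = x & g 1 = y])
  /\ (forall g : R -> pt R, {within `[0, 1]%classic, continuous g} ->
     g @` `[0, 1]%classic `<=` A -> g 0 = g 1 ->
     exists G : R * R -> pt R,
       [/\ {within `[0, 1]%classic `*` `[0, 1]%classic, continuous G},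
           G @` (`[0, 1]%classic `*` `[0, 1]%classic) `<=` A,
           (forall s, `[0, 1]%classic s -> G (0, s) = g s /\ G (1, s) = g 0)
         & (forall r, `[0, 1]%classic r -> G (r, 0) = g 0 /\ G (r, 1) = g 0)]).

Definition polyhedral_domain (R : realType) (Omega : set (pt R)) : Prop :=
  [/\ Omega !=set0, bounded_set Omega, simply_connected Omega
    & convex_polyhedron Omega].

(* Index arithmetic in 'I_3 is modulo 3. *)

Definition cross (R : realType) (u v : 'rV[R]_3) : 'rV[R]_3 :=
  \row_(j < 3) (u 0 (j + 1) * v 0 (j + 2%:R) - u 0 (j + 2%:R) * v 0 (j + 1)).

(* The curl of a field with Jacobian matrix J, where J i j = d_j u_i. *)
Definition curlmx (R : realType) (J : 'M[R]_3) : 'rV[R]_3 :=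
  \row_(j < 3) (J (j + 2%:R) (j + 1) - J (j + 1) (j + 2%:R)).

Definition dotmx (R : realType) m n (A B : 'M[R]_(m, n)) : R :=
  \sum_i \sum_j A i j * B i j.

Definition vcomp (R : realType) (u : pt R -> 'rV[R]_3) (i : 'I_3) : pt R -> R :=
  fun x => u x 0 i.

(* An element of L^2(Omega) is represented by any function in its class; only
   the values in Omega matter. *)

Definition L2 (R : realType) (Omega : set (pt R)) : set (pt R -> R) :=
  [set f | (f \_ Omega) \in Lfun (leb3 R) 2%:E].

Definition vL2 (R : realType) (Omega : set (pt R)) : set (pt R -> 'rV[R]_3) :=
  [set u | forall i, L2 Omega (vcomp u i)].

Definition aeq (R : realType) (Omega : set (pt R)) (T : Type) (f g : pt R -> T)
    : Prop := ae_eq (leb3 R) Omega f g.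

Definition ips (R : realType) (Omega : set (pt R)) (f g : pt R -> R) : R :=
  (\int[leb3 R]_(x in Omega) (f x * g x))%R.

(* The Lebesgue integral of the pointwise product: it also makes sense when one
   factor is not in L^2 but the product is integrable, as may happen for the
   cross-product terms of the scheme. *)
Definition ip (R : realType) (Omega : set (pt R)) m n
    (F G : pt R -> 'M[R]_(m, n)) : R :=
  (\int[leb3 R]_(x in Omega) dotmx (F x) (G x))%R.

Definition nrms (R : realType) (Omega : set (pt R)) (f : pt R -> R) : R :=
  Num.sqrt (ips Omega f f).

Definition nrm (R : realType) (Omega : set (pt R)) m n
    (F : pt R -> 'M[R]_(m, n)) : R := Num.sqrt (ip Omega F F).

Fixpoint Ck (R : realType) (V : normedModType R) (k : nat) (f : V -> R) : Prop :=
  continuous f /\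
  if k is k'.+1
  then forall v, (forall x, derivable f x v) /\ Ck k' (fun x => 'D_v f x)
  else True.

Definition smooth (R : realType) (V : normedModType R) (f : V -> R) : Prop :=
  forall k, Ck k f.

Definition test_function (R : realType) (Omega : set (pt R)) (phi : pt R -> R)
    : Prop :=
  [/\ smooth phi, compact (closure [set x | phi x != 0])
    & closure [set x | phi x != 0] `<=` Omega].

Definition is_wpartial (R : realType) (Omega : set (pt R)) (j : 'I_3)
    (f g : pt R -> R) : Prop :=
  forall phi, test_function Omega phi ->
    ips Omega f (fun x => 'D_(axis R j) phi x) = - ips Omega g phi.

(* A square-integrable weak partial derivative, unique a.e. in Omega when it
   exists; 0 by default. *)
Definition wpartial (R : realType) (Omega : set (pt R)) (j : 'I_3)
    (f : pt R -> R) : pt R -> R :=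
  xget (fun=> 0) [set g | L2 Omega g /\ is_wpartial Omega j f g].

Definition H1 (R : realType) (Omega : set (pt R)) : set (pt R -> R) :=
  [set f | L2 Omega f /\
    forall j, exists g, L2 Omega g /\ is_wpartial Omega j f g].

(* The closure of the test functions in H^1(Omega). *)
Definition H10 (R : realType) (Omega : set (pt R)) : set (pt R -> R) :=
  [set f | H1 Omega f /\ exists phi : nat -> pt R -> R,
    [/\ forall n, test_function Omega (phi n),
        nrms Omega (phi n \- f) @[n --> \oo] --> (0 : R)
      & forall j, nrms Omega ((fun x => 'D_(axis R j) (phi n) x)
                              \- wpartial Omega j f) @[n --> \oo] --> (0 : R)]].

Definition vH10 (R : realType) (Omega : set (pt R)) : set (pt R -> 'rV[R]_3) :=
  [set u | forall i, H10 Omega (vcomp u i)].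

Definition sgrad (R : realType) (Omega : set (pt R)) (f : pt R -> R)
    : pt R -> 'rV[R]_3 := fun x => \row_j wpartial Omega j f x.

Definition grad (R : realType) (Omega : set (pt R)) (u : pt R -> 'rV[R]_3)
    : pt R -> 'M[R]_3 := fun x => \matrix_(i, j) wpartial Omega j (vcomp u i) x.

Definition div (R : realType) (Omega : set (pt R)) (u : pt R -> 'rV[R]_3)
    : pt R -> R := fun x => \tr (grad Omega u x).

Definition curl (R : realType) (Omega : set (pt R)) (u : pt R -> 'rV[R]_3)
    : pt R -> 'rV[R]_3 := fun x => curlmx (grad Omega u x).

Definition jacobian (R : realType) (u : pt R -> 'rV[R]_3) (x : pt R) : 'M[R]_3 :=
  \matrix_(i, j) 'D_(axis R j) (vcomp u i) x.

(* Fields depending on time are written [ha t x]. *)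
Definition dt (R : realType) (ha : R -> pt R -> 'rV[R]_3) (s : R)
    : pt R -> 'rV[R]_3 :=
  fun x => \row_i derive1 (fun r => vcomp (ha r) i x) s.

(* Smoothness up to the boundary of the closed set closure(Omega) x [0, tF] is
   the existence of a smooth extension to R^3 x R. *)
Definition smooth_field (R : realType) (Omega : set (pt R)) (tF : R)
    (ha : R -> pt R -> 'rV[R]_3) : Prop :=
  forall i : 'I_3, exists g : pt R * R -> R, smooth g /\
    forall t x, `[0, tF]%classic t -> closure Omega x -> vcomp (ha t) i x = g (x, t).

Definition applied_field (R : realType) (Omega : set (pt R)) (tF : R)
    (ha : R -> pt R -> 'rV[R]_3) : Prop :=
  smooth_field Omega tF ha /\
  forall t x, `[0, tF]%classic t -> Omega x ->
    curlmx (jacobian (ha t) x) = 0 /\ \tr (jacobian (ha t) x) = 0.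

Record material (R : realType) := Material {
  nu : R; nur : R; mu0 : R; jm : R; c1 : R; c2 : R; kappa0 : R; TT : R }.

Definition nu0 (R : realType) (c : material R) : R := nu c + nur c.

Definition admissible (R : realType) (c : material R) : Prop :=
  [/\ [/\ 0 <= nu c, 0 <= nur c, 0 <= mu0 c & 0 <= jm c],
      0 <= c1 c, 0 <= c2 c, 0 <= kappa0 c & 0 < TT c].

Record discretization (R : realType) := Discretization {
  UU : set (pt R -> 'rV[R]_3);
  PP : set (pt R -> R);
  WW : set (pt R -> 'rV[R]_3);
  MM : set (pt R -> 'rV[R]_3);
  XX : set (pt R -> R);
  bh : (pt R -> 'rV[R]_3) -> (pt R -> 'rV[R]_3) -> (pt R -> 'rV[R]_3) -> R;
  bm : (pt R -> 'rV[R]_3) -> (pt R -> 'rV[R]_3) -> (pt R -> 'rV[R]_3) -> R }.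

Definition UW (R : realType) (D : discretization R) : set (pt R -> 'rV[R]_3) :=
  [set u + w | u in UU D & w in WW D].

(* S is a finite dimensional subspace of A, where A is a space of functions
   modulo a.e. equality in Omega; S contains all representatives lying in A of
   its classes. *)
Definition fd_subspace (R : realType) (Omega : set (pt R)) (V : lmodType R)
    (A S : set (pt R -> V)) : Prop :=
  exists n (e : 'I_n -> pt R -> V), (forall i, A (e i)) /\
    S = [set v | A v /\ exists a : 'I_n -> R,
                   aeq Omega v (\sum_(i < n) a i *: e i)].

(* A form on A x B x C that is well defined on classes modulo a.e. equality
   and linear in each argument. *)
Definition trilinear (R : realType) (Omega : set (pt R))
    (A B C : set (pt R -> 'rV[R]_3))
    (b : (pt R -> 'rV[R]_3) -> (pt R -> 'rV[R]_3) -> (pt R -> 'rV[R]_3) -> R)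
    : Prop :=
  [/\ forall u u' v v' w w', A u -> A u' -> B v -> B v' -> C w -> C w' ->
        aeq Omega u u' -> aeq Omega v v' -> aeq Omega w w' ->
        b u v w = b u' v' w',
      forall a u u' v w, A u -> A u' -> B v -> C w ->
        b (a *: u + u') v w = a * b u v w + b u' v w,
      forall a u v v' w, A u -> B v -> B v' -> C w ->
        b u (a *: v + v') w = a * b u v w + b u v' w
    & forall a u v w w', A u -> B v -> C w -> C w' ->
        b u v (a *: w + w') = a * b u v w + b u v w'].

Definition skew_in_last_two (R : realType) (A B : set (pt R -> 'rV[R]_3))
    (b : (pt R -> 'rV[R]_3) -> (pt R -> 'rV[R]_3) -> (pt R -> 'rV[R]_3) -> R)
    : Prop :=
  forall u v w, A u -> B v -> B w -> b u v w = - b u w v.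

Definition discrete_setting (R : realType) (Omega : set (pt R))
    (D : discretization R) : Prop :=
  [/\ [/\ fd_subspace Omega (vH10 Omega) (UU D),
          fd_subspace Omega (L2 Omega : set (pt R -> R^o)) (PP D),
          fd_subspace Omega (vH10 Omega) (WW D),
          fd_subspace Omega (vL2 Omega) (MM D)
        & fd_subspace Omega (H1 Omega : set (pt R -> R^o)) (XX D)],
      trilinear Omega (UU D) (UW D) (UW D) (bh D)
    & trilinear Omega (UU D) (MM D) (MM D) (bm D)].

(* LBB stability of a family of pairs (U_h, P_h), h in hs: the constant does
   not depend on h. *)
Definition LBB_stable (R : realType) (Omega : set (pt R)) (hs : set R)
    (D : R -> discretization R) : Prop :=
  exists2 beta : R, 0 < beta & forall h, hs h ->
    forall Q, PP (D h) Q -> (\int[leb3 R]_(x in Omega) Q x)%R = 0 ->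
      ((beta * nrms Omega Q)%:E <=
       ereal_sup [set (ips Omega (div Omega V) Q / nrm Omega (grad Omega V))%:E
                 | V in [set V | UU (D h) V /\ ~ aeq Omega V 0%R]])%E.

Record state (R : realType) := State {
  sU : pt R -> 'rV[R]_3;
  sP : pt R -> R;
  sW : pt R -> 'rV[R]_3;
  sM : pt R -> 'rV[R]_3;
  sPhi : pt R -> R }.

Definition sH (R : realType) (Omega : set (pt R)) (s : state R)
    : pt R -> 'rV[R]_3 := sgrad Omega (sPhi s).

Definition delta (V : zmodType) (f : nat -> V) (k : nat) : V := f k - f k.-1.

Definition tau (R : realType) (tF : R) (K : nat) : R := tF / K%:R.

Definition tk (R : realType) (tF : R) (K k : nat) : R := k%:R * tau tF K.

Definition poisson_eq (R : realType) (Omega : set (pt R)) (tF : R) (K : nat)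
    (ha : R -> pt R -> 'rV[R]_3) (D : discretization R) (s : nat -> state R)
    (k : nat) : Prop :=
  forall chi, XX D chi ->
    ip Omega (sgrad Omega (sPhi (s k))) (sgrad Omega chi) =
    ip Omega (ha (tk tF K k) - sM (s k)) (sgrad Omega chi).

Definition momentum_eq (R : realType) (Omega : set (pt R)) (c : material R)
    (tF : R) (K : nat) (D : discretization R) (s : nat -> state R)
    (k : nat) : Prop :=
  forall V, UU D V ->
    ip Omega ((tau tF K)^-1 *: delta (fun n => sU (s n)) k) V
    + bh D (sU (s k)) (sU (s k)) V
    + nu0 c * ip Omega (grad Omega (sU (s k))) (grad Omega V)
    - ips Omega (sP (s k)) (div Omega V)
    = 2 * nur c * ip Omega (curl Omega (sW (s k))) V
      + mu0 c * bm D V (sH Omega (s k)) (sM (s k)).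

Definition incompressibility_eq (R : realType) (Omega : set (pt R))
    (D : discretization R) (s : nat -> state R) (k : nat) : Prop :=
  forall Q, PP D Q -> ips Omega Q (div Omega (sU (s k))) = 0.

Definition spin_eq (R : realType) (Omega : set (pt R)) (c : material R)
    (tF : R) (K : nat) (D : discretization R) (s : nat -> state R)
    (k : nat) : Prop :=
  forall X, WW D X ->
    jm c * ip Omega ((tau tF K)^-1 *: delta (fun n => sW (s n)) k) X
    + jm c * bh D (sU (s k)) (sW (s k)) X
    + c1 c * ip Omega (grad Omega (sW (s k))) (grad Omega X)
    + c2 c * ips Omega (div Omega (sW (s k))) (div Omega X)
    + 4 * nur c * ip Omega (sW (s k)) X
    = 2 * nur c * ip Omega (curl Omega (sU (s k))) X
      + mu0 c *
        ip Omega (fun x => cross (sM (s k) x) (sH Omega (s k) x)) X.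

Definition magnetization_eq (R : realType) (Omega : set (pt R)) (c : material R)
    (tF : R) (K : nat) (D : discretization R) (s : nat -> state R)
    (k : nat) : Prop :=
  forall Z, MM D Z ->
    ip Omega ((tau tF K)^-1 *: delta (fun n => sM (s n)) k) Z
    - bm D (sU (s k)) Z (sM (s k))
    + ip Omega (fun x => cross (sM (s k) x) (sW (s k) x)) Z
    + (TT c)^-1 * ip Omega (sM (s k)) Z
    = kappa0 c / TT c * ip Omega (sH Omega (s k)) Z.

(* The component sP (s 0) is not part of the discrete solution and is left
   unconstrained. *)
Definition scheme_solution (R : realType) (Omega : set (pt R)) (c : material R)
    (tF : R) (K : nat) (ha : R -> pt R -> 'rV[R]_3) (D : discretization R)
    (s : nat -> state R) : Prop :=
  [/\ forall k, (k <= K)%N ->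
        [/\ UU D (sU (s k)), WW D (sW (s k)), MM D (sM (s k)),
            XX D (sPhi (s k)) & poisson_eq Omega tF K ha D s k]
    & forall k, (1 <= k <= K)%N ->
        [/\ PP D (sP (s k)) /\ momentum_eq Omega c tF K D s k,
            incompressibility_eq Omega D s k,
            spin_eq Omega c tF K D s k
          & magnetization_eq Omega c tF K D s k]].

Definition energy (R : realType) (Omega : set (pt R)) (c : material R)
    (s : nat -> state R) (k : nat) : R :=
  2^-1 * (nrm Omega (sU (s k)) ^+ 2 + jm c * nrm Omega (sW (s k)) ^+ 2
          + mu0 c * nrm Omega (sM (s k)) ^+ 2
          + mu0 c * nrm Omega (sH Omega (s k)) ^+ 2).

Definition increments (R : realType) (Omega : set (pt R)) (c : material R)
    (s : nat -> state R) (k : nat) : R :=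
  2^-1 * (nrm Omega (delta (fun n => sU (s n)) k) ^+ 2
          + jm c * nrm Omega (delta (fun n => sW (s n)) k) ^+ 2
          + mu0 c * nrm Omega (delta (fun n => sM (s n)) k) ^+ 2
          + mu0 c * nrm Omega (delta (fun n => sH Omega (s n)) k) ^+ 2).

Definition dissipation (R : realType) (Omega : set (pt R)) (c : material R)
    (s : nat -> state R) (k : nat) : R :=
  nu c * nrm Omega (grad Omega (sU (s k))) ^+ 2
  + c1 c * nrm Omega (grad Omega (sW (s k))) ^+ 2
  + nur c * nrms Omega (div Omega (sU (s k))) ^+ 2
  + c2 c * nrms Omega (div Omega (sW (s k))) ^+ 2
  + nur c * nrm Omega (curl Omega (sU (s k)) - 2 *: sW (s k)) ^+ 2
  + mu0 c / TT c * nrm Omega (sM (s k)) ^+ 2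
  + mu0 c / (2 * TT c) * (2^-1 + 3 * kappa0 c) * nrm Omega (sH Omega (s k)) ^+ 2.

Definition forcing (R : realType) (Omega : set (pt R)) (c : material R)
    (tF : R) (K : nat) (ha : R -> pt R -> 'rV[R]_3) (k : nat) : R :=
  TT c * mu0 c / tau tF K *
    (\int[@lebesgue_measure R]_(r in `[tk tF K k.-1, tk tF K k])
       (nrm Omega (dt ha r) ^+ 2))%R
  + mu0 c / (2 * TT c) * (1 + kappa0 c) * nrm Omega (ha (tk tF K k)) ^+ 2.

(* Main.v *)
(* Testing the scheme with V = U^k, Q = P^k, X = W^k and Z = mu_0 M^k, mu_0 H^k (admissible
   because grad X is contained in M) kills the skew-symmetric forms and the pressure, and the
   remaining b_h^m and cross-product terms cancel when the equations are added.  Subtracting two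
   consecutive Poisson equations turns (delta M^k, H^k) into (delta h_a^k, H^k) - (delta H^k, H^k),
   and Young's inequality together with |delta h_a^k|^2 <= tau * int |d_t h_a|^2 bounds the right
   hand side.  The dissipation is recovered from (curl W, U) = (W, curl U) and
   |grad U|^2 = |curl U|^2 + |div U|^2 on H^1_0, both proved by approximation with test functions.

   Skew-symmetry of b_h may only be used on U + W, so U^k must be written as U^k + 0 with 0 in W;
   that the zero field belongs to H^1_0 means that its weak derivatives, which are chosen by an
   epsilon, vanish almost everywhere.  This is the fundamental lemma of the calculus of variations:
   smooth cutoffs of half-spaces show that a function orthogonal to all test functions has zero
   integral over all convex polyhedra contained in Omega, and these generate the Borel sets. *)

Require Import Defs.
From HB Require Import structures.
From mathcomp Require Import all_boot all_order all_algebra.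
From mathcomp Require Import all_classical all_reals all_analysis.
From mathcomp Require Import measurable_realfun.
From mathcomp Require Import ring lra.

Import Order.TTheory GRing.Theory Num.Theory.
Import numFieldNormedType.Exports.

Local Open Scope classical_set_scope.
Local Open Scope ring_scope.

Set Implicit Arguments.
Unset Strict Implicit.
Unset Printing Implicit Defensive.

Local Notation mpt R := (measurableTypeR R * measurableTypeR R * measurableTypeR R)%type.

(** * Directional derivatives and flat exponentials *)

Section directional_derivatives.
Context {R : realType} {V : normedModType R}.
Implicit Types (f : V -> R) (x v w : V).

(** The difference quotients of [f] along [v] and of its restriction to the line are literally the
    same functions of [h], so existence and value of the derivative transfer together. *)
Lemma growth_rate_line f x v (t : R) :
  (fun h => h^-1 *: (((fun s => f (s *: v + x)) \o shift t) (h *: (1 : R))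
                     - f (t *: v + x))) =
  (fun h : R => h^-1 *: ((f \o shift (t *: v + x)) (h *: v) - f (t *: v + x))).
Proof.
by apply/funext => h /=; rewrite [h *: 1]mulr1 scalerDl addrA.
Qed.

Lemma derive_line f x v t : 'D_1 (fun s : R => f (s *: v + x)) t = 'D_v f (t *: v + x).
Proof. by rewrite /derive growth_rate_line. Qed.

Lemma is_derive_line f x v t (d : R) : is_derive (t *: v + x) v f d ->
  is_derive t 1 (fun s : R => f (s *: v + x)) d.
Proof.
move=> [df <-]; split; last exact: derive_line.
by rewrite /derivable growth_rate_line.
Qed.

Lemma mean_value_line f x v (e : R) : 0 < e -> (forall y, derivable f y v) ->
  exists2 s, 0 < s < e & f (e *: v + x) - f x = e * 'D_v f (s *: v + x).
Proof.
move=> e0 df.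
have dl (t : R) : is_derive t 1 (fun s : R => f (s *: v + x)) ('D_v f (t *: v + x)).
  exact/is_derive_line/derivableP.
have cl : {within `[0, e], continuous (fun s : R => f (s *: v + x))}.
  apply: continuous_subspaceT => t.
  by apply/differentiable_continuous/derivable1_diffP; have [] := dl t.
have [s] := MVT e0 (fun t _ => dl t) cl.
by rewrite in_itv/= => sI; rewrite scale0r add0r subr0 mulrC; exists s.
Qed.

(** The mean value theorem is used twice: along [v] for the increment of [f] by [e *: w], then along
    [w] for ['D_v f]. The left-hand side is symmetric in [v] and [w], which is what makes it useful
    for mixed derivatives. *)
Lemma second_difference f x v w (e : R) : 0 < e ->
  (forall y, derivable f y v) -> (forall y, derivable ('D_v f) y w) ->
  exists s t, [/\ 0 < s < e, 0 < t < e &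
    f (e *: v + (e *: w + x)) - f (e *: w + x) - (f (e *: v + x) - f x) =
    e * (e * 'D_w ('D_v f) (t *: w + (s *: v + x)))].
Proof.
move=> e0 df ddf.
pose g := (f \o shift (e *: w)) - f.
have dsh y : is_derive y v (f \o shift (e *: w)) ('D_v f (y + e *: w)).
  have [dfy dE] := derivableP (df (y + e *: w)); split.
    rewrite /derivable; under eq_fun do rewrite /= -addrA.
    exact: dfy.
  rewrite /derive; under eq_fun do rewrite /= -addrA.
  exact: dE.
have dg y : is_derive y v g ('D_v f (y + e *: w) - 'D_v f y).
  exact: (@is_deriveB _ _ _ _ _ _ _ _ _ (dsh y) (derivableP (df y))).
have [|s sI] := @mean_value_line g x v e e0.
  by move=> y; have [] := dg y.
rewrite derive_val => E.
have [t tI E'] := @mean_value_line ('D_v f) (s *: v + x) w e e0 ddf.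
exists s, t; split => //; rewrite -E'.
rewrite [e *: w + (s *: v + x)]addrC -E /g /= !fctE /=.
by rewrite -[e *: v + x + e *: w]addrA ![x + e *: w]addrC; ring.
Qed.

Lemma dist_halves (a b z d : R) : `|a - z| < d / 2 -> `|b - z| < d / 2 -> `|a - b| < d.
Proof.
move=> az bz; rewrite [d]splitr; apply: le_lt_trans (ler_distD z a b) _.
by rewrite ltrD// distrC.
Qed.

(** Schwarz's theorem: one second difference equals [e * e] times either mixed derivative, each at
    some point near [x], and continuity at [x] makes both values close to those at [x]. *)
Lemma derive_comm f x v w :
  (forall y, derivable f y v) -> (forall y, derivable f y w) ->
  (forall y, derivable ('D_v f) y w) -> (forall y, derivable ('D_w f) y v) ->
  {for x, continuous ('D_w ('D_v f))} -> {for x, continuous ('D_v ('D_w f))} ->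
  'D_w ('D_v f) x = 'D_v ('D_w f) x.
Proof.
move=> dv dw dvw dwv c1 c2.
apply/eqP; rewrite -subr_eq0 -normr_le0; apply/ler_addgt0Pl => d d0.
rewrite addr0.
have d2 : 0 < d / 2 by rewrite divr_gt0.
have /cvgrPdist_lt /(_ _ d2) /nbhs_ballP [/= r1 r10 b1] := c1.
have /cvgrPdist_lt /(_ _ d2) /nbhs_ballP [/= r2 r20 b2] := c2.
pose r := Num.min r1 r2.
have r0 : 0 < r by rewrite lt_min r10 r20.
(* With [e = r / n], every point reached by steps shorter than [e] along [v] and [w] stays within
   [r] of [x]; the summand 1 keeps [n] positive when both directions vanish. *)
pose n := `|v| + `|w| + 1.
have n0 : 0 < n by rewrite ltr_wpDl ?addr_ge0.
pose e := r / n.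
have e0 : 0 < e by rewrite divr_gt0.
have cl (a b : V) (s t : R) : `|a| + `|b| + 1 = n -> 0 < s < e -> 0 < t < e ->
    `|x - (t *: b + (s *: a + x))| < r.
  move=> abn /andP[s0 se] /andP[t0 te].
  rewrite addrA opprD addrCA subrr addr0 normrN.
  rewrite (le_lt_trans (ler_normD _ _))// !normrZ !gtr0_norm//.
  have -> : r = e * n by rewrite /e divfK// gt_eqF.
  rewrite -abn mulrDr mulr1 mulrDr [e * `|a| + _]addrC.
  rewrite ltr_pwDr//.
  by apply: lerD; apply: ler_wpM2r => //; exact: ltW.
have [s [t [sI tI E]]] := @second_difference f x v w e e0 dv dvw.
have [s' [t' [sI' tI' E']]] := @second_difference f x w v e e0 dw dwv.
have EE : 'D_w ('D_v f) (t *: w + (s *: v + x)) =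
          'D_v ('D_w f) (t' *: v + (s' *: w + x)).
  move: E E'; rewrite [e *: w + (e *: v + x)]addrCA.
  move: ('D_w ('D_v f) _) ('D_v ('D_w f) _) => A B.
  move: (f _) (f _) (f _) (f _) => a b a' b' E E'.
  apply: (@mulfI _ (e * e)); first by rewrite mulf_neq0 ?gt_eqF.
  have -> : e * e * A = e * (e * A) by ring.
  have -> : e * e * B = e * (e * B) by ring.
  by rewrite -E -E'; ring.
have h1 : `|'D_w ('D_v f) x - 'D_w ('D_v f) (t *: w + (s *: v + x))| < d / 2.
  apply: b1; rewrite -ball_normE; apply: (lt_le_trans (cl v w s t erefl sI tI)).
  by rewrite ge_min lexx.
have h2 : `|'D_v ('D_w f) x - 'D_v ('D_w f) (t' *: v + (s' *: w + x))| < d / 2.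
  apply: b2; rewrite -ball_normE; apply: (lt_le_trans (cl w v s' t' _ sI' tI')).
    by rewrite /n [`|w| + _]addrC.
  by rewrite ge_min lexx orbT.
by apply: ltW; apply: dist_halves h1 _; rewrite EE.
Qed.

End directional_derivatives.

(** * Flat functions vanishing to infinite order at 0 *)

Section flat_functions.
Context {R : realType}.
Implicit Types (t h : R) (n : nat).

(** The classical flat function is the case [n = 0]; negative powers are included so that the linear
    span of the family is closed under differentiation. *)
Definition flatexp n t : R := if 0 < t then t^-1 ^+ n * expR (- t^-1) else 0.

Lemma flatexp_le0 n t : t <= 0 -> flatexp n t = 0.
Proof. by rewrite /flatexp ltNge => ->. Qed.

(** A single term of the exponential series at [t^-1], that of degree [n.+2], bounds [expR t^-1]
    from below. A quadratic bound is enough for the derivative at 0 to vanish. *)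
Lemma flatexp_quadratic n t : `|flatexp n t| <= (n.+2)`!%:R * t ^+ 2.
Proof.
rewrite /flatexp; case: ifPn => t0; last by rewrite normr0 mulr_ge0 ?sqr_ge0.
have y0 : 0 < t^-1 by rewrite invr_gt0.
rewrite ger0_norm ?(mulr_ge0, exprn_ge0, expR_ge0, ltW y0)//.
have f0 : 0 < (n.+2)`!%:R :> R by rewrite ltr0n fact_gt0.
have : t^-1 ^+ n.+2 / (n.+2)`!%:R <= expR t^-1.
  by apply: le_trans (@expR_ge1Dxn R t^-1 n.+1 (ltW y0)); rewrite lerDr ler01.
set F := (n.+2)`!%:R in f0 *.
rewrite expRN ler_pdivrMr// => H.
rewrite ler_pdivrMr ?expR_gt0//.
rewrite -(ler_pM2r (exprn_gt0 2 y0)) -exprD addn2.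
have -> : F * t ^+ 2 * expR t^-1 * t^-1 ^+ 2 = expR t^-1 * F * (t * t^-1) ^+ 2 by ring.
by rewrite divff ?gt_eqF// expr1n mulr1.
Qed.

Lemma is_derive_flatexp n t :
  is_derive t 1 (flatexp n) (flatexp n.+2 t - n%:R * flatexp n.+1 t).
Proof.
have [t0|t0|->] := ltgtP t 0.
- rewrite !flatexp_le0 ?ltW// mulr0 subr0.
  apply: (@near_eq_is_derive _ _ _ (cst 0)).
  near=> s; rewrite /= flatexp_le0//.
  by apply: ltW; near: s; apply: open_nbhs_nbhs; split => //; exact: open_lt.
- apply: (@near_eq_is_derive _ _ _ (fun s : R => s^-1 ^+ n * expR (- s^-1)) (flatexp n)).
    near=> s; rewrite /flatexp; have -> // : 0 < s.
    by near: s; apply: open_nbhs_nbhs; split => //; exact: open_gt.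
  rewrite /flatexp t0.
  have tn0 : t != 0 by rewrite gt_eqF.
  have dV : is_derive t 1 (fun s : R => s^-1) (- t ^- 2).
    have := @is_deriveV _ id t 1 1 tn0 (is_derive_id _ _).
    by rewrite /= [_ *: 1]mulr1.
  have dN : is_derive t 1 (fun s : R => - s^-1) (t ^- 2).
    by have := @is_deriveN _ _ _ _ _ _ _ dV; rewrite opprK.
  have dE : is_derive t 1 (fun s : R => expR (- s^-1)) (t ^- 2 * expR (- t^-1)).
    have := @is_derive1_comp _ expR (fun s : R => - s^-1) t _ _ (is_derive_expR _) dN.
    by rewrite mulrC.
  have dX : is_derive t 1 (fun s : R => s^-1 ^+ n) (- (n%:R * t^-1 ^+ n.+1)).
    have := @is_deriveX _ _ _ n t 1 _ dV.
    rewrite /= exprfctE => /is_derive_eq; apply.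
    rewrite -exprVn /GRing.scale/=; case: n => [|m]; first by rewrite !mul0r oppr0.
    by rewrite /= !exprS expr0; ring.
  have := @is_deriveM _ _ _ _ _ _ _ _ dX dE.
  move=> /is_derive_eq; apply.
  rewrite -exprVn !exprS expr0 /GRing.scale/=; ring.
- rewrite !flatexp_le0// mulr0 subr0.
  have : h^-1 *: ((flatexp n \o shift 0) (h *: (1 : R)) - flatexp n 0) @[h --> 0^'] --> 0.
    apply/cvgr0Pnorm_le => e e0.
    set C : R := (n.+2)`!%:R.
    have C0 : 0 < C by rewrite ltr0n fact_gt0.
    near=> h.
    have hn0 : h != 0 by near: h; exact: nbhs_dnbhs_neq.
    rewrite /= addr0 [h *: 1]mulr1 (@flatexp_le0 _ 0)// subr0 normrM normfV.
    rewrite mulrC ler_pdivrMr ?normr_gt0// (le_trans (flatexp_quadratic _ _))//.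
    rewrite -/C -real_normK ?num_real// expr2 mulrA.
    rewrite ler_wpM2r// mulrC -ler_pdivlMr//.
    by near: h; apply: dnbhs0_le; exact: divr_gt0.
  move=> H; split; first by apply/cvg_ex; exists 0.
  by apply/cvg_lim.
Unshelve. all: by end_near. Qed.

Lemma continuous_flatexp n : continuous (flatexp n).
Proof.
move=> t; apply/differentiable_continuous/derivable1_diffP.
by have [] := is_derive_flatexp n t.
Qed.

Lemma flatexp0_ge0 t : 0 <= flatexp 0 t.
Proof. by rewrite /flatexp; case: ifP => // _; rewrite expr0 mul1r expR_ge0. Qed.

Lemma flatexp0_le1 t : flatexp 0 t <= 1.
Proof.
rewrite /flatexp; case: ifP => // t0; rewrite expr0 mul1r expR_le1 oppr_le0.
by rewrite invr_ge0 ltW.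
Qed.

(** Once [y = (N%:R * s - 1)^-1] is positive and at most [e], the inequality [expR (- y) >= 1 - y]
    closes the gap to 1. *)
Lemma flatexp0_cvg s : 0 < s -> flatexp 0 (N%:R * s - 1) @[N --> \oo] --> (1 : R).
Proof.
move=> s0; apply/cvgrPdist_le => e e0.
near=> N.
have H : 0 < N%:R * s - 1 /\ e^-1 <= N%:R * s - 1.
  have H1 : 1 + 1 <= N%:R * s /\ 1 + e^-1 <= N%:R * s.
    split; rewrite -ler_pdivrMr//; near: N; exact: nbhs_infty_ger.
  split; first by case: H1 => H1 _; lra.
  by case: H1 => _ H1; lra.
have [p0 pe] := H.
rewrite ger0_norm ?subr_ge0 ?flatexp0_le1//.
rewrite /flatexp p0 expr0 mul1r.
have := expR_ge1Dx (- (N%:R * s - 1)^-1).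
set y := (N%:R * s - 1)^-1.
have : y <= e by rewrite /y -[e]invrK lef_pV2// posrE invr_gt0.
by move=> ye yE; lra.
Unshelve. all: by end_near. Qed.

End flat_functions.

(** * Measurability of continuous functions and the space L^2 *)

(* [M] stands for the sigma-algebra.  It is not the one of a [measurableType] structure on [T]
   because topology and measurability live on different aliases of R; below [M] is the pullback
   of a sigma-algebra along the identity. *)
Definition countably_based (T : topologicalType) (M : set (set T)) : Prop :=
  exists B : nat -> set T, (forall n, M (B n)) /\
    forall x U, nbhs x U -> exists2 n, B n x & B n `<=` U.

(** An open set is the union of the basic sets it contains; basic sets not contained in [U] are
    replaced by the empty set, so that the union stays indexed by [nat]. *)
Lemma countably_based_open (T : topologicalType) (M : set (set T)) (U : set T) :
  M set0 -> (forall F : nat -> set T, (forall n, M (F n)) -> M (\bigcup_n F n)) ->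
  countably_based M -> open U -> M U.
Proof.
move=> M0 MU [B [MB bB]] oU.
pose F n := [set x | B n x /\ B n `<=` U].
have -> : U = \bigcup_n F n.
  apply/seteqP; split => [x Ux|x [n _ [Bx BU]]]; last exact: BU.
  have /bB[n Bx BU] : nbhs x U by exact: open_nbhs_nbhs.
  by exists n.
apply: MU => n; have [BU|BU] := pselect (B n `<=` U).
  by rewrite (_ : F n = B n)//; apply/seteqP; split => x // [].
by rewrite (_ : F n = set0)//; apply/seteqP; split => x // [].
Qed.

Lemma countably_basedX d1 d2 (T1 : measurableType d1) (T2 : measurableType d2)
    (S1 S2 : topologicalType) (e1 : S1 -> T1) (e2 : S2 -> T2) :
  countably_based [set A : set S1 | exists2 B, measurable B & A = e1 @^-1` B] ->
  countably_based [set A : set S2 | exists2 B, measurable B & A = e2 @^-1` B] ->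
  countably_based [set A : set (S1 * S2) |
    exists2 B : set (T1 * T2), measurable B & A = (fun z => (e1 z.1, e2 z.2)) @^-1` B].
Proof.
move=> [B1 [M1 b1]] [B2 [M2 b2]].
pose B n := if (unpickle n : option (nat * nat)) is Some ij
  then B1 ij.1 `*` B2 ij.2 else set0.
exists B; split.
- move=> n; rewrite /B; case: (unpickle n) => [[i j]|/=]; last first.
    by exists set0 => //; rewrite preimage_set0.
  have [C1 mC1 ->] := M1 i; have [C2 mC2 ->] := M2 j.
  by exists (C1 `*` C2) => //; exact: measurableX.
- move=> [x y] U [[/= V1 V2] [/= n1 n2] VU].
  have [i Bx BV1] := b1 _ _ n1; have [j By BV2] := b2 _ _ n2.
  exists (pickle (i, j)); rewrite /B pickleK//=.
  by move=> [a b] [/= /BV1 ? /BV2 ?]; exact: VU.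
Qed.

(** The base consists of the balls with rational centres and radii [m.+1%:R^-1], numbered through
    the countable type [rat * nat]. *)
Lemma countably_basedR (R : realType) :
  countably_based [set A : set R |
    exists2 B : set (measurableTypeR R), measurable B & A = id @^-1` B].
Proof.
pose B n := if (unpickle n : option (rat * nat)) is Some qm
  then ball (ratr qm.1 : R) qm.2.+1%:R^-1 else set0.
exists B; split.
- move=> n; exists (B n) => //; rewrite /B; case: (unpickle n) => [[q m]|//].
  by apply: open_measurable; exact: ball_open.
- move=> x U /nbhs_ballP[/= e e0 xU].
  have [m me] : exists m : nat, m.+1%:R^-1 < e / 2.
    have e2 : 0 < e / 2 by rewrite divr_gt0.
    by have [m] := ltr_add_invr e2; rewrite add0r => ?; exists m.
  have m0 : 0 < m.+1%:R^-1 :> R by rewrite invr_gt0.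
  have xx : (x - m.+1%:R^-1 < x + m.+1%:R^-1 :> R).
    by rewrite ltrD2l (lt_trans _ m0)// oppr_lt0.
  have [q] := rat_in_itvoo xx.
  rewrite in_itv/= => /andP[q1 q2].
  exists (pickle (q, m)); rewrite /B pickleK/= -ball_normE/=.
    by rewrite ltr_distl q1 q2.
  move=> y/= qy; apply: xU; rewrite -ball_normE/=.
  rewrite (le_lt_trans (ler_distD (ratr q) _ _))// [e]splitr ltrD ?(lt_trans _ me)//.
  by rewrite distrC ltr_distl q1 q2.
Qed.

Section continuous_measurable.
Context {R : realType}.

Lemma open_measurable_pt (U : set (pt R)) : open U ->
  measurable (U : set (mpt R)).
Proof.
move=> oU.
have cb := countably_basedX (countably_basedX (countably_basedR R) (countably_basedR R))
  (countably_basedR R).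
have [||B mB ->] := countably_based_open _ _ cb oU.
- by exists set0.
- move=> F mF; pose G n := sval (cid2 (mF n)).
  exists (\bigcup_n G n).
    by apply: bigcupT_measurable => n; rewrite /G; case: cid2.
  rewrite preimage_bigcup; apply: eq_bigcupr => n _.
  by rewrite /G; case: cid2.
- by rewrite (_ : _ @^-1` B = B)//; apply/seteqP; split => -[[a b] c].
Qed.

Lemma open_measurable_ptR (U : set (pt R * R)) : open U ->
  measurable (U : set (mpt R * measurableTypeR R)).
Proof.
move=> oU.
have cb := countably_basedX (countably_basedX
  (countably_basedX (countably_basedR R) (countably_basedR R))
  (countably_basedR R)) (countably_basedR R).
have [||B mB ->] := countably_based_open _ _ cb oU.
- by exists set0.
- move=> F mF; pose G n := sval (cid2 (mF n)).
  exists (\bigcup_n G n).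
    by apply: bigcupT_measurable => n; rewrite /G; case: cid2.
  rewrite preimage_bigcup; apply: eq_bigcupr => n _.
  by rewrite /G; case: cid2.
- by rewrite (_ : _ @^-1` B = B)//; apply/seteqP; split => -[[[a b] c] t].
Qed.

Lemma continuous_measurable_pt (f : pt R -> R) : continuous f ->
  measurable_fun (setT : set (mpt R)) f.
Proof.
move=> /continuousP cf; apply: (measurability _ (RGenInftyO.measurableE R)).
move=> _ [_ [x ->] <-]; rewrite setTI.
by apply: open_measurable_pt; apply: cf; exact: interval_open.
Qed.

Lemma continuous_measurable_ptR (f : pt R * R -> R) : continuous f ->
  measurable_fun (setT : set (mpt R * measurableTypeR R)) f.
Proof.
move=> /continuousP cf; apply: (measurability _ (RGenInftyO.measurableE R)).
move=> _ [_ [x ->] <-]; rewrite setTI.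
by apply: open_measurable_ptR; apply: cf; exact: interval_open.
Qed.

End continuous_measurable.

Lemma Rintegral_sum d (T : measurableType d) (R : realType) (mu : {measure set T -> \bar R})
    (D : set T) (I : Type) (r : seq I) (h : I -> T -> R) : measurable D ->
  (forall i, mu.-integrable D (EFin \o h i)) ->
  mu.-integrable D (EFin \o (fun x => \sum_(i <- r) h i x)) /\
  (\int[mu]_(x in D) (\sum_(i <- r) h i x) =
    \sum_(i <- r) \int[mu]_(x in D) h i x)%R.
Proof.
move=> mD ih; elim: r => [|i r [IH1 IH2]].
  split.
    rewrite (_ : _ \o _ = cst 0%E); first exact: integrable0.
    by apply/funext => x /=; rewrite big_nil.
  rewrite big_nil /Rintegral (eq_integral (cst 0%E)) ?integral0// => x _.
  by rewrite big_nil.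
have E x : \sum_(j <- i :: r) h j x = h i x + \sum_(j <- r) h j x by rewrite big_cons.
split.
  rewrite (_ : _ \o _ = (EFin \o h i) \+ (EFin \o (fun x => \sum_(j <- r) h j x))).
    exact: integrableD.
  by apply/funext => x /=; rewrite E.
rewrite big_cons -IH2 -RintegralD//.
by apply: eq_Rintegral => x _; rewrite E.
Qed.

(** * Inner product, Cauchy-Schwarz inequality and matrix-valued fields in L^2 *)

Section L2_theory.
Context {R : realType} (Omega : set (pt R)).
Hypothesis mO : measurable (Omega : set (mpt R)).
Hypothesis fO : (leb3 R Omega < +oo)%E.
Notation mu := (leb3 R).
Implicit Types f g : pt R -> R.

Lemma L2_integrableM f g : L2 Omega f -> L2 Omega g ->
  mu.-integrable Omega (EFin \o (fun x => f x * g x)).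
Proof.
move=> Lf Lg; apply/(integrable_mkcond _ mO).
have /Lfun1_integrable := Lfun2_mul_Lfun1 Lf Lg.
congr (mu.-integrable _ _); apply/funext => x /=.
by rewrite /patch; case: ifP => //; rewrite mulr0.
Qed.

Lemma L2_restrictD f g : (f \+ g) \_ Omega = f \_ Omega + g \_ Omega.
Proof.
by apply/funext => x; rewrite /patch /= fctE; case: ifP => //; rewrite addr0.
Qed.

Let p1 : (1 <= 2%:E :> \bar R)%E. Proof. by rewrite lee_fin ler1n. Qed.

Lemma L2D f g : L2 Omega f -> L2 Omega g -> L2 Omega (f \+ g).
Proof.
move=> Lf Lg; rewrite /L2 /= L2_restrictD.
by apply: (Lfun_addr_closed mu p1).2.
Qed.

Lemma L2Z a f : L2 Omega f -> L2 Omega (fun x => a * f x).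
Proof.
move=> Lf; rewrite /L2 /=.
have -> : (fun x => a * f x) \_ Omega = a \o* (f \_ Omega).
  by apply/funext => x; rewrite /patch/=; case: ifP => // _; rewrite ?mulr0 ?mul0r// mulrC.
by apply: Lfun_scale => //; rewrite ler1n.
Qed.

Lemma L2B f g : L2 Omega f -> L2 Omega g -> L2 Omega (f \- g).
Proof.
move=> Lf Lg; have := L2D Lf (L2Z (-1) Lg).
by congr (L2 _ _); apply/funext => x /=; rewrite mulN1r.
Qed.

Lemma L2_bounded f (M : R) : measurable_fun Omega f ->
  (forall x, Omega x -> `|f x| <= M) -> L2 Omega f.
Proof.
move=> mf fM; apply/andP; split; rewrite inE/=.
  exact/(measurable_restrictT f mO).
rewrite /finite_norm unlock poweR_lty//.
apply: (@le_lt_trans _ _ (\int[mu]_(x in Omega) (M ^+ 2)%:E)%E); last first.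
  by rewrite integral_cst// lte_mul_pinfty// lee_fin sqr_ge0.
rewrite [leRHS]integral_mkcond.
have mp : measurable_fun setT (f \_ Omega) by exact/(measurable_restrictT f mO).
have -> : (\int[mu]_x (`|(EFin \o f \_ Omega) x| `^ 2) = \int[mu]_x (((f \_ Omega) x) ^+ 2)%:E)%E.
  by apply: eq_integral => x _; rewrite /= ?abse_EFin ?poweR_EFin powR_mulrn// real_normK ?num_real.
apply: ge0_le_integral => //.
- by move=> x _; rewrite lee_fin sqr_ge0.
- exact/measurable_EFinP/measurable_funX.
- by apply/(measurable_restrictT _ mO); exact: measurable_cst.
- move=> x _; rewrite /patch; case: ifPn => [/[!inE] xO|_]; rewrite lee_fin; last by rewrite expr0n.
  by rewrite -real_normK ?num_real// ler_sqr ?nnegrE ?fM// (le_trans _ (fM x xO)).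
Qed.

Lemma ipsC f g : ips Omega f g = ips Omega g f.
Proof. by apply: eq_Rintegral => x _; rewrite mulrC. Qed.

Lemma ips_ge0 f : 0 <= ips Omega f f.
Proof. by apply: Rintegral_ge0 => x _; rewrite -expr2 sqr_ge0. Qed.

Lemma nrms_sqr f : nrms Omega f ^+ 2 = ips Omega f f.
Proof. by rewrite sqr_sqrtr// ips_ge0. Qed.

Lemma ipsDl f g e : L2 Omega f -> L2 Omega g -> L2 Omega e ->
  ips Omega (f \+ g) e = ips Omega f e + ips Omega g e.
Proof.
move=> Lf Lg Le; rewrite -RintegralD//; try exact: L2_integrableM.
by apply: eq_Rintegral => x _ /=; rewrite mulrDl.
Qed.

Lemma ipsZl a f e : L2 Omega f -> L2 Omega e ->
  ips Omega (fun x => a * f x) e = a * ips Omega f e.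
Proof.
move=> Lf Le; rewrite -RintegralZl//; try exact: L2_integrableM.
by apply: eq_Rintegral => x _ /=; rewrite mulrA.
Qed.

Lemma ipsBl f g e : L2 Omega f -> L2 Omega g -> L2 Omega e ->
  ips Omega (f \- g) e = ips Omega f e - ips Omega g e.
Proof.
move=> Lf Lg Le; rewrite -RintegralB//; try exact: L2_integrableM.
by apply: eq_Rintegral => x _ /=; rewrite mulrBl.
Qed.

Lemma ipsBr f g e : L2 Omega f -> L2 Omega g -> L2 Omega e ->
  ips Omega e (f \- g) = ips Omega e f - ips Omega e g.
Proof. by move=> Lf Lg Le; rewrite ipsC ipsBl// ![ips _ _ e]ipsC. Qed.

Lemma ipsZr a f e : L2 Omega f -> L2 Omega e ->
  ips Omega e (fun x => a * f x) = a * ips Omega e f.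
Proof. by move=> Lf Le; rewrite ipsC ipsZl// [ips _ _ e]ipsC. Qed.

Lemma ips_quadratic f g a : L2 Omega f -> L2 Omega g ->
  0 <= ips Omega f f - 2 * a * ips Omega f g + a ^+ 2 * ips Omega g g.
Proof.
move=> Lf Lg.
have Lag := L2Z a Lg; have Ld := L2B Lf Lag.
have := ips_ge0 (f \- (fun x => a * g x)).
rewrite ipsBl// !ipsBr// !ipsZl// !ipsZr// [ips _ g f]ipsC.
move: (ips _ f f) (ips _ f g) (ips _ g g) => p b q.
by rewrite (_ : p - a * b - (a * b - a * (a * q)) = p - 2 * a * b + a ^+ 2 * q)//; ring.
Qed.

(** Discriminant argument for the nonnegative quadratic polynomial [|f - a g|^2] in [a]. *)
Lemma ips_CS f g : L2 Omega f -> L2 Omega g ->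
  `|ips Omega f g| <= nrms Omega f * nrms Omega g.
Proof.
move=> Lf Lg; rewrite -(@ler_pXn2r _ 2)// ?nnegrE ?mulr_ge0 ?sqrtr_ge0//.
rewrite real_normK ?num_real// exprMn !nrms_sqr.
have H a := ips_quadratic a Lf Lg; move: H.
have := ips_ge0 f; have := ips_ge0 g.
move: (ips _ f g) (ips _ f f) (ips _ g g) => b p q q0 p0 H.
have [q00|qn0] := eqVneq q 0.
  suff -> : b = 0 by rewrite expr0n/= mulr_ge0.
  (* For [q = 0] the polynomial is affine in [a]; at this value of [a] it would equal -1. *)
  apply/eqP/negPn/negP => b0; have := H ((p + 1) / (2 * b)).
  rewrite q00 mulr0 addr0 (_ : 2 * ((p + 1) / (2 * b)) * b = p + 1); first by lra.
  by field.
have qp : 0 < q by rewrite lt_def qn0.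
(* The minimiser of the quadratic polynomial is [b / q]. *)
have := mulr_ge0 (H (b / q)) q0.
rewrite (_ : (p - 2 * (b / q) * b + (b / q) ^+ 2 * q) * q = p * q - b ^+ 2); last by field.
by rewrite subr_ge0.
Qed.

(** Strong convergence implies weak convergence, by Cauchy-Schwarz. This is how identities for test
    functions pass to H^1_0. *)
Lemma ips_cvg (phi : nat -> pt R -> R) f g :
  (forall n, L2 Omega (phi n)) -> L2 Omega f -> L2 Omega g ->
  nrms Omega (phi n \- f) @[n --> \oo] --> (0 : R) ->
  ips Omega (phi n) g @[n --> \oo] --> ips Omega f g.
Proof.
move=> Lphi Lf Lg cphi; apply/cvgrPdist_le => e e0.
have k0 : 0 < nrms Omega g + 1 by rewrite ltr_wpDl ?sqrtr_ge0.
move/cvgrPdist_le : cphi => /(_ (e / (nrms Omega g + 1)) (divr_gt0 e0 k0)).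
apply: filterS => n; rewrite sub0r normrN ger0_norm ?sqrtr_ge0// => H.
rewrite distrC -ipsBl// (le_trans (ips_CS (L2B (Lphi n) Lf) Lg))//.
rewrite ler_pdivlMr// in H; apply: le_trans H.
by rewrite ler_wpM2l ?sqrtr_ge0// lerDl.
Qed.

(** Arbitrary matrix sizes let vector fields and their gradients share one set of rules for [ip]. *)
Definition mL2 m n (F : pt R -> 'M[R]_(m, n)) := forall i j, L2 Omega (fun x => F x i j).

Lemma ip_sum m n (F G : pt R -> 'M[R]_(m, n)) : mL2 F -> mL2 G ->
  ip Omega F G = \sum_i \sum_j ips Omega (fun x => F x i j) (fun x => G x i j).
Proof.
move=> LF LG.
have h i : mu.-integrable Omega (EFin \o (fun x => \sum_j F x i j * G x i j)).
  by apply: (Rintegral_sum _ mO _).1 => j; exact: L2_integrableM.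
rewrite /ip /Defs.dotmx (Rintegral_sum _ mO h).2; apply: eq_bigr => i _.
by rewrite (Rintegral_sum _ mO _).2// => j; exact: L2_integrableM.
Qed.

Lemma ipC m n (F G : pt R -> 'M[R]_(m, n)) : ip Omega F G = ip Omega G F.
Proof.
apply: eq_Rintegral => x _; apply: eq_bigr => i _; apply: eq_bigr => j _.
by rewrite mulrC.
Qed.

Lemma mL2D m n (F G : pt R -> 'M[R]_(m, n)) : mL2 F -> mL2 G -> mL2 (F + G).
Proof.
move=> LF LG i j; have := L2D (LF i j) (LG i j).
by congr (L2 _ _); apply/funext => x; rewrite /= fctE mxE.
Qed.

Lemma mL2Z m n a (F : pt R -> 'M[R]_(m, n)) : mL2 F -> mL2 (a *: F).
Proof.
move=> LF i j; have := L2Z a (LF i j).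
by congr (L2 _ _); apply/funext => x; rewrite /= fctE mxE.
Qed.

Lemma mL2B m n (F G : pt R -> 'M[R]_(m, n)) : mL2 F -> mL2 G -> mL2 (F - G).
Proof. by move=> LF LG; rewrite -scaleN1r; apply: mL2D => //; exact: mL2Z. Qed.

Lemma ipDl m n (F G H : pt R -> 'M[R]_(m, n)) : mL2 F -> mL2 G -> mL2 H ->
  ip Omega (F + G) H = ip Omega F H + ip Omega G H.
Proof.
move=> LF LG LH; rewrite !ip_sum//; last exact: mL2D.
rewrite -big_split; apply: eq_bigr => i _; rewrite -big_split; apply: eq_bigr => j _.
rewrite /= -ipsDl//; congr (ips _ _ _).
by apply/funext => x; rewrite /= fctE mxE.
Qed.

Lemma ipZl m n a (F H : pt R -> 'M[R]_(m, n)) : mL2 F -> mL2 H ->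
  ip Omega (a *: F) H = a * ip Omega F H.
Proof.
move=> LF LH; rewrite !ip_sum//; last exact: mL2Z.
rewrite mulr_sumr; apply: eq_bigr => i _; rewrite mulr_sumr; apply: eq_bigr => j _.
rewrite -ipsZl//; congr (ips _ _ _).
by apply/funext => x; rewrite /= fctE mxE.
Qed.

Lemma ipBl m n (F G H : pt R -> 'M[R]_(m, n)) : mL2 F -> mL2 G -> mL2 H ->
  ip Omega (F - G) H = ip Omega F H - ip Omega G H.
Proof.
move=> LF LG LH; rewrite -scaleN1r ipDl//; last exact: mL2Z.
by rewrite ipZl// mulN1r.
Qed.

Lemma ip_ge0 m n (F : pt R -> 'M[R]_(m, n)) : 0 <= ip Omega F F.
Proof.
apply: Rintegral_ge0 => x _; apply: sumr_ge0 => i _; apply: sumr_ge0 => j _.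
by rewrite -expr2 sqr_ge0.
Qed.

Lemma nrm_sqr m n (F : pt R -> 'M[R]_(m, n)) : nrm Omega F ^+ 2 = ip Omega F F.
Proof. by rewrite sqr_sqrtr// ip_ge0. Qed.

End L2_theory.

(** * Test functions and the fundamental lemma of the calculus of variations *)

Section linear_functionals.
Context {R : realType}.
Implicit Types (a x v : pt R) (h : R).

Lemma pdot_line a x v h : pdot a (h *: v + x) = h * pdot a v + pdot a x.
Proof.
by case: a x v => [[a1 a2] a3] [[x1 x2] x3] [[v1 v2] v3]; rewrite /pdot /=;
 change (a1 * (h * v1 + x1) + a2 * (h * v2 + x2) + a3 * (h * v3 + x3) =
  h * (a1 * v1 + a2 * v2 + a3 * v3) + (a1 * x1 + a2 * x2 + a3 * x3)); ring.
Qed.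

Lemma continuous_pdot a : continuous (pdot a).
Proof.
have c11 : continuous (fun x : pt R => x.1.1).
  by move=> x; apply: (@continuous_comp _ _ _ (@fst (R * R) R) (@fst R R)); exact: cvg_fst.
have c12 : continuous (fun x : pt R => x.1.2).
  by move=> x; apply: (@continuous_comp _ _ _ (@fst (R * R) R) (@snd R R));
    [exact: cvg_fst|exact: cvg_snd].
have c2 : continuous (fun x : pt R => x.2) by move=> x; exact: cvg_snd.
move=> x; apply: cvgD; [apply: cvgD|]; apply: cvgM; try exact: cvg_cst.
- exact: c11.
- exact: c12.
- exact: c2.
Qed.

End linear_functionals.

(** * Smooth cutoffs of intersections of half-spaces *)

Section flat_algebra.
Context {R : realType}.

(** The pair [c = (a, b)] encodes the half-space [a.x < b]. For [k > 0] the ramp is positive where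
    [b - a.x > 1/k], so [flatexp n] of it is supported at a positive gap from the boundary, and the
    gap closes as [k] grows. *)
Definition ramp (k : R) (c : pt R * R) (x : pt R) : R := k * (c.2 - pdot c.1 x) - 1.

Lemma continuous_ramp k c : continuous (ramp k c).
Proof.
move=> x; apply: cvgB; last exact: cvg_cst.
apply: cvgM; first exact: cvg_cst.
by apply: cvgB; [exact: cvg_cst|exact: continuous_pdot].
Qed.

(** A class of functions containing the cutoffs and closed under directional derivatives: smoothness
    of all orders then follows by induction on the order, without computing any higher
    derivative. *)
Inductive flatalg : (pt R -> R) -> Prop :=
| flatalg_cst k : flatalg (fun=> k)
| flatalg_ramp n k c : flatalg (fun x => flatexp n (ramp k c x))
| flatalgD f g : flatalg f -> flatalg g -> flatalg (fun x => f x + g x)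
| flatalgM f g : flatalg f -> flatalg g -> flatalg (fun x => f x * g x).

Lemma flatalg_continuous f : flatalg f -> continuous f.
Proof.
elim=> [k|n k c|{}f g _ cf _ cg|{}f g _ cf _ cg] x.
- exact: cvg_cst.
- apply: (@continuous_comp _ _ _ (ramp k c) (flatexp n)); first exact: continuous_ramp.
  exact: continuous_flatexp.
- by apply: cvgD; [exact: cf|exact: cg].
- by apply: cvgM; [exact: cf|exact: cg].
Qed.

Lemma is_derive_ramp n k c x v : is_derive x v (fun x => flatexp n (ramp k c x))
  (- k * pdot c.1 v * (flatexp n.+2 (ramp k c x) - n%:R * flatexp n.+1 (ramp k c x))).
Proof.
pose d := - k * pdot c.1 v.
(* On the line through [x] along [v] the ramp is this affine function, so the one-variable chain
   rule suffices. *)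
pose l : R -> R := cst (ramp k c x) + d *: (@id R).
have lE s : l s = ramp k c x + d * s by [].
have E : (fun s : R => flatexp n (ramp k c (s *: v + x))) = flatexp n \o l.
  by apply/funext => s /=; rewrite lE /ramp pdot_line /d; congr (flatexp n _); ring.
have dl : is_derive (0 : R) 1 l d.
  have H1 : is_derive (0 : R) (1 : R) (d *: (@id R)) (d *: (1 : R)) by exact: is_deriveZ.
  have H2 : is_derive (0 : R) (1 : R) l (0 + d *: (1 : R)) by exact: is_deriveD.
  by apply: is_derive_eq H2 _; rewrite add0r [_ *: _]mulr1.
have := @is_derive1_comp _ (flatexp n) l 0 _ _ (is_derive_flatexp n _) dl.
rewrite -E lE mulr0 addr0 => -[D1 D2]; split; first exact/derivable1P.
have := derive_line (fun x => flatexp n (ramp k c x)) x v 0.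
by rewrite scale0r add0r => <-; rewrite D2 mulrC.
Qed.

Lemma flatalg_derive f v : flatalg f ->
  exists2 g, flatalg g & forall x, is_derive x v f (g x).
Proof.
elim=> [k|n k c|{}f g Hf [f' Hf' df] Hg [g' Hg' dg]|{}f g Hf [f' Hf' df] Hg [g' Hg' dg]].
- by exists (fun=> 0); [exact: flatalg_cst|move=> x; exact: is_derive_cst].
- exists (fun x => (- k * pdot c.1 v) *
      (flatexp n.+2 (ramp k c x) + (- n%:R) * flatexp n.+1 (ramp k c x))).
    by do ![apply: flatalg_cst|apply: flatalgM|apply: flatalgD|apply: flatalg_ramp].
  by move=> x; have := @is_derive_ramp n k c x v; rewrite mulNr.
- exists (fun x => f' x + g' x); first exact: flatalgD.
  by move=> x; exact: is_deriveD.
- exists (fun x => f x * g' x + g x * f' x).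
    by apply: flatalgD; exact: flatalgM.
  by move=> x; exact: is_deriveM.
Qed.

Lemma flatalg_smooth f : flatalg f -> smooth f.
Proof.
move=> Hf k; elim: k f Hf => [|k IH] f Hf; first by split => //; exact: flatalg_continuous.
split; first exact: flatalg_continuous.
move=> v; have [g Hg dg] := flatalg_derive v Hf.
split; first by move=> x; have [] := dg x.
rewrite (_ : (fun x => _) = g); first exact: IH.
by apply/funext => x; have [_] := dg x.
Qed.

Definition cutoff (k : R) (L : seq (pt R * R)) (x : pt R) : R :=
  \prod_(c <- L) flatexp 0 (ramp k c x).

Lemma cutoff_cons k c L : cutoff k (c :: L) = (fun x => flatexp 0 (ramp k c x) * cutoff k L x).
Proof. by apply/funext => x; rewrite /cutoff big_cons. Qed.

Lemma cutoff_flatalg k L : flatalg (cutoff k L).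
Proof.
elim: L => [|c L IH].
  rewrite (_ : cutoff k [::] = fun=> 1); first exact: flatalg_cst.
  by apply/funext => x; rewrite /cutoff big_nil.
by rewrite cutoff_cons; apply: flatalgM => //; exact: flatalg_ramp.
Qed.

Lemma cutoff_ge0 k L x : 0 <= cutoff k L x.
Proof. by apply: prodr_ge0 => c _; exact: flatexp0_ge0. Qed.

Lemma cutoff_le1 k L x : cutoff k L x <= 1.
Proof.
elim: L => [|c L IH]; first by rewrite /cutoff big_nil.
by rewrite cutoff_cons mulr_ile1 ?flatexp0_ge0 ?cutoff_ge0 ?flatexp0_le1.
Qed.

(** Lists of constraints make intersection a concatenation, so the cells form a pi-system; the empty
    list gives the whole space. *)
Definition cell (L : seq (pt R * R)) : set (pt R) :=
  [set x | all (fun c => pdot c.1 x < c.2) L].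

Lemma cell_cat L1 L2 : cell (L1 ++ L2) = cell L1 `&` cell L2.
Proof.
by apply/seteqP; split=> x; rewrite /cell/= all_cat => /andP.
Qed.

Lemma open_cell L : open (cell L).
Proof.
elim: L => [|c L IH].
  by rewrite (_ : cell [::] = setT); [exact: openT|apply/seteqP; split].
rewrite -cat1s cell_cat; apply: openI => //.
rewrite (_ : cell [:: c] = pdot c.1 @^-1` [set y | y < c.2]).
  by apply: open_comp; [move=> x _; exact: continuous_pdot|exact: open_lt].
by apply/seteqP; split => x; rewrite /cell/= andbT.
Qed.

Lemma measurable_cell L : measurable (cell L : set (mpt R)).
Proof. by apply: open_measurable_pt; exact: open_cell. Qed.

Lemma cutoff_cvg L x : cutoff N.+1%:R L x @[N --> \oo] --> ((x \in cell L)%:R : R).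
Proof.
elim: L => [|c L IH].
  rewrite mem_set// (_ : (fun N => _) = cst 1); first exact: cvg_cst.
  by apply/funext => N; rewrite /cutoff big_nil.
under eq_fun do rewrite cutoff_cons.
rewrite -cat1s cell_cat in_setI -mulnb natrM; apply: cvgM => //.
have [cx|cx] := boolP (x \in cell [:: c]).
  have c0 : 0 < c.2 - pdot c.1 x.
    by move: cx; rewrite inE /cell/= andbT subr_gt0.
  have := flatexp0_cvg c0; rewrite -(cvg_shiftS (fun N => flatexp 0 _)).
  exact.
rewrite (_ : (fun N => _) = cst 0); first exact: cvg_cst.
apply/funext => N; rewrite flatexp_le0// /ramp.
have c0 : c.2 - pdot c.1 x <= 0.
  rewrite subr_le0 leNgt; apply: contra cx => cx.
  by rewrite inE /cell/= andbT.
by rewrite subr_le0 (le_trans _ ler01)// mulr_ge0_le0.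
Qed.

(** The conclusion is a non-strict inequality, hence a closed condition that also holds on the
    closure of the set where the cutoff is nonzero. *)
Lemma cutoff_support k L x : 0 < k -> cutoff k L x != 0 ->
  all (fun c => 1 <= k * (c.2 - pdot c.1 x)) L.
Proof.
move=> k0; elim: L => [//|c L IH]; rewrite cutoff_cons mulf_eq0 negb_or => /andP[c0 cL].
rewrite /= (IH cL) andbT leNgt; apply: contra c0 => c0.
by rewrite flatexp_le0// /ramp subr_le0 ltW.
Qed.

Lemma closed_halfspaces k (L : seq (pt R * R)) :
  closed [set x | all (fun c => 1 <= k * (c.2 - pdot c.1 x)) L].
Proof.
elim: L => [|c L IH].
  by rewrite (_ : mkset _ = setT); [exact: closedT|apply/seteqP; split].
rewrite (_ : mkset _ = (ramp k c @^-1` [set y | 0 <= y]) `&`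
  [set x | all (fun c => 1 <= k * (c.2 - pdot c.1 x)) L]).
  apply: closedI => //; apply: closed_comp; last exact: closed_ge.
  by move=> x _; exact: continuous_ramp.
by apply/seteqP; split => x/=; rewrite /ramp subr_ge0 => /andP.
Qed.

End flat_algebra.

(** * Compactness and finite measure from boundedness *)

Section bounded_domain.
Context {R : realType} (Omega : set (pt R)).
Hypothesis bO : bounded_set Omega.

Definition cube (M : R) : set (pt R) := (`[-M, M] `*` `[-M, M]) `*` `[-M, M].

Lemma bounded_subset_cube : exists M, Omega `<=` cube M.
Proof.
have [M [_ HM]] := bO.
(* Boundedness provides a bound by every number strictly larger than [M], but not by [M] itself. *)
exists (M + 1) => -[[x1 x2] x3] Ox.
have MM : M < M + 1 by rewrite ltrDl.
have := HM _ MM _ Ox; rewrite /= prod_normE/= ge_max prod_normE/= ge_max => /andP[/andP[H1 H2] H3].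
by split; [split|] => /=; rewrite in_itv/= -ler_norml.
Qed.

Lemma compact_cube M : compact (cube M).
Proof. by do ![apply: compact_setX|apply: segment_compact]. Qed.

Lemma leb3_cube_lty M : (leb3 R (cube M) < +oo)%E.
Proof.
have mI : measurable (`[- M, M]%classic : set (measurableTypeR R)) by exact: measurable_itv.
have -> : leb3 R (cube M) = (lebesgue_measure `[(- M)%R, M]%classic *
    lebesgue_measure `[(- M)%R, M]%classic * lebesgue_measure `[(- M)%R, M]%classic)%E.
  rewrite -(product_measure1E _ _ mI mI) -(product_measure1E _ _ (measurableX mI mI) mI).
  by [].
rewrite !lebesgue_measure_itv.
by case: ifP => _; rewrite ?mule0 ?ltry.
Qed.

Lemma closed_subset_compact (K : set (pt R)) : closed K -> K `<=` Omega -> compact K.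
Proof.
move=> cK KO; have [M OM] := bounded_subset_cube.
exact: (subclosed_compact cK (@compact_cube M) (subset_trans KO OM)).
Qed.

Lemma closure_compact : compact (closure Omega).
Proof.
have [M OM] := bounded_subset_cube.
apply: (subclosed_compact (@closed_closure _ Omega) (@compact_cube M)).
have : closed (cube M) by apply: compact_closed; [exact: norm_hausdorff|exact: (@compact_cube M)].
by move=> /closure_id ->; exact: closure_subset.
Qed.

Lemma leb3_lty : measurable (Omega : set (mpt R)) -> (leb3 R Omega < +oo)%E.
Proof.
move=> mO; have [M OM] := bounded_subset_cube.
apply: le_lt_trans (leb3_cube_lty M); apply: le_measure => //; rewrite inE//.
by apply: measurableX => //; exact: measurableX.
Qed.

End bounded_domain.

Lemma L2_integrable {R : realType} (Omega : set (pt R)) f :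
  measurable (Omega : set (mpt R)) -> (leb3 R Omega < +oo)%E -> L2 Omega f ->
  (leb3 R).-integrable Omega (EFin \o f).
Proof.
move=> mO fO Lf.
have L1 : L2 Omega (fun=> 1).
  by apply: (@L2_bounded _ _ mO fO _ 1) => // x _; rewrite normr1.
have := L2_integrableM mO Lf L1; congr (_.-integrable _ _).
by apply/funext => x /=; rewrite mulr1.
Qed.

(** * Test functions and integration by parts in H^1_0 *)

Section test_functions.
Context {R : realType} (Omega : set (pt R)).
Hypothesis bO : bounded_set Omega.
Hypothesis mO : measurable (Omega : set (mpt R)).

Let fO : (leb3 R Omega < +oo)%E := leb3_lty bO mO.

Lemma smooth_continuous (f : pt R -> R) : smooth f -> continuous f.
Proof. by move=> /(_ 0%N)[]. Qed.

Lemma smooth_derivable (f : pt R -> R) v x : smooth f -> derivable f x v.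
Proof. by move=> /(_ 1%N)[_ /(_ v)[]]. Qed.

Lemma smooth_derive (f : pt R -> R) v : smooth f -> smooth ('D_v f).
Proof. by move=> sf k; have [_ /(_ v)[]] := sf k.+1. Qed.

Lemma smooth_derive_comm (f : pt R -> R) v w x : smooth f ->
  'D_w ('D_v f) x = 'D_v ('D_w f) x.
Proof.
move=> sf; apply: derive_comm; try by move=> y; exact: smooth_derivable.
- by move=> y; apply/smooth_derivable/smooth_derive.
- by move=> y; apply/smooth_derivable/smooth_derive.
- by apply: smooth_continuous; do 2 apply: smooth_derive.
- by apply: smooth_continuous; do 2 apply: smooth_derive.
Qed.

(** Off the closed support, [phi] vanishes in a whole neighbourhood, hence so does its derivative:
    the support cannot grow. *)
Lemma test_function_derive phi v : test_function Omega phi -> test_function Omega ('D_v phi).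
Proof.
move=> [sphi cphi sub].
have CE : closure (closure [set x | phi x != 0]) = closure [set x | phi x != 0].
  exact/esym/closure_id/closed_closure.
have S : closure [set x | 'D_v phi x != 0] `<=` closure [set x | phi x != 0].
  rewrite -CE.
  apply: closure_subset => x; apply: contraPP => nx.
  have : \forall y \near x, cst 0 y = phi y.
    have oC : open (~` closure [set x | phi x != 0]) by apply: closed_openC; exact: closed_closure.
    have : nbhs x (~` closure [set x | phi x != 0]) by exact: open_nbhs_nbhs.
    apply: filterS => y ny.
    by apply/esym/eqP/negP => /negP p; apply: ny; apply: subset_closure.
  by move=> H; rewrite /= -(near_eq_derive v H) derive_cst eqxx.
split; first exact: smooth_derive.
- by apply: subclosed_compact cphi S; exact: closed_closure.
- exact: subset_trans S sub.
Qed.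

Lemma test_function_L2 phi : test_function Omega phi -> L2 Omega phi.
Proof.
move=> [sphi cphi sub].
have [M [_ HM]] : bounded_set (phi @` closure [set x | phi x != 0]).
  apply: compact_bounded; apply: continuous_compact => //.
  exact/continuous_subspaceT/smooth_continuous.
apply: (@L2_bounded _ _ mO fO _ (Num.max (M + 1) 0)).
  apply: measurable_funTS; apply: continuous_measurable_pt; exact: smooth_continuous.
move=> x _; have [->|p0] := eqVneq (phi x) 0; first by rewrite normr0 le_max lexx orbT.
have MM : M < M + 1 by rewrite ltrDl.
rewrite le_max (HM _ MM)//; exists x => //; exact: subset_closure.
Qed.

(** On H^1 the set from which [wpartial] chooses is nonempty, so the default value 0 is never taken
    without satisfying the specification. *)
Lemma wpartialP j f : H1 Omega f ->
  L2 Omega (wpartial Omega j f) /\ is_wpartial Omega j f (wpartial Omega j f).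
Proof. move=> [_ /(_ j)[g Hg]].
have := @xgetPex _ (fun=> 0) [set g | L2 Omega g /\ is_wpartial Omega j f g].
by apply; exists g. Qed.

Lemma H10_L2 f : H10 Omega f -> L2 Omega f.
Proof. by case=> -[]. Qed.

Lemma H10_wpartial_L2 j f : H10 Omega f -> L2 Omega (wpartial Omega j f).
Proof. by case=> /(wpartialP j)[]. Qed.

(** For a test function in place of [g] this is the definition of the weak derivative of [f]; both
    sides converge along the sequence approximating [g]. *)
Lemma H10_ibp j f g : H1 Omega f -> H10 Omega g ->
  ips Omega (wpartial Omega j f) g = - ips Omega f (wpartial Omega j g).
Proof.
move=> Hf Hg; have [_ [phi [tphi cphi dphi]]] := Hg.
have [Lf' wf] := wpartialP j Hf; have Lf := Hf.1.
have Lg := H10_L2 Hg; have Lg' := H10_wpartial_L2 j Hg.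
have Lphi n := test_function_L2 (tphi n).
have Ldphi n := test_function_L2 (test_function_derive (axis R j) (tphi n)).
have c1 := ips_cvg mO Lphi Lg Lf' cphi.
have c2 := ips_cvg mO Ldphi Lg' Lf (dphi j).
have E : (fun n => ips Omega (phi n) (wpartial Omega j f)) =
         (fun n => - ips Omega ('D_(axis R j) (phi n)) f).
  apply/funext => n; rewrite [RHS]/= [ips _ _ f]ipsC.
  by rewrite (wf _ (tphi n)) opprK ipsC.
rewrite E in c1.
have := cvg_unique _ c1 (cvgN c2).
by rewrite ![ips _ _ f]ipsC [ips _ g _]ipsC; apply.
Qed.

(** For a test function [phi] in place of [g], both sides equal minus the product of [f] with a
    mixed second derivative of [phi], and these derivatives commute. Density concludes; no second
    derivative of [f] or [g] is involved. *)
Lemma H10_swap i j f g : H1 Omega f -> H10 Omega g ->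
  ips Omega (wpartial Omega i f) (wpartial Omega j g) =
  ips Omega (wpartial Omega j f) (wpartial Omega i g).
Proof.
move=> Hf Hg; have [_ [phi [tphi _ dphi]]] := Hg.
have [Lfi wfi] := wpartialP i Hf; have [Lfj wfj] := wpartialP j Hf; have Lf := Hf.1.
have Lgi := H10_wpartial_L2 i Hg; have Lgj := H10_wpartial_L2 j Hg.
have td n k := test_function_derive (axis R k) (tphi n).
have c1 := ips_cvg mO (fun n => test_function_L2 (td n j)) Lgj Lfi (dphi j).
have c2 := ips_cvg mO (fun n => test_function_L2 (td n i)) Lgi Lfj (dphi i).
have E : (fun n => ips Omega ('D_(axis R j) (phi n)) (wpartial Omega i f)) =
         (fun n => ips Omega ('D_(axis R i) (phi n)) (wpartial Omega j f)).
  apply/funext => n; apply: oppr_inj.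
  rewrite [ips _ _ (wpartial Omega i f)]ipsC [ips _ _ (wpartial Omega j f)]ipsC.
  apply: etrans (esym (wfi _ (td n j))) _; apply: etrans _ (wfj _ (td n i)).
  have D : 'D_(axis R i) ('D_(axis R j) (phi n)) = 'D_(axis R j) ('D_(axis R i) (phi n)).
    by apply/funext => x; apply: smooth_derive_comm; have [] := tphi n.
  exact: (congr1 (ips Omega f) D).
rewrite E in c1.
rewrite [LHS]ipsC [RHS]ipsC.
exact: (cvg_unique _ c1 c2).
Qed.

End test_functions.

(** * Fundamental lemma of the calculus of variations on a polyhedron *)

Section fundamental_lemma.
Context {R : realType} (L0 : seq (pt R * R)).
Let Omega := cell L0.
Hypothesis bO : bounded_set Omega.

Let mO : measurable (Omega : set (mpt R)) := measurable_cell L0.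

(** The constraints of [L0] in the list push the support into a closed set inside the bounded
    [Omega], which is therefore compact. *)
Lemma cutoff_test_function N L : test_function Omega (cutoff N.+1%:R (L0 ++ L)).
Proof.
have k0 : 0 < N.+1%:R :> R by [].
pose K := [set x : pt R | all (fun c => 1 <= N.+1%:R * (c.2 - pdot c.1 x)) (L0 ++ L)].
have cK : closed K by exact: closed_halfspaces.
have SK : closure [set x | cutoff N.+1%:R (L0 ++ L) x != 0] `<=` K.
  rewrite [X in _ `<=` X](closure_id K).1//; apply: closure_subset => x /=.
  exact: cutoff_support.
have KO : K `<=` Omega.
  move=> x; rewrite /K /= all_cat => /andP[+ _]; apply: sub_all => c /= c1.
  by rewrite -subr_gt0 -(pmulr_rgt0 _ k0) (lt_le_trans ltr01).
split.
- exact/flatalg_smooth/cutoff_flatalg.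
- apply: subclosed_compact SK; first exact: closed_closure.
  exact: (@closed_subset_compact R Omega bO K cK KO).
- exact: subset_trans SK KO.
Qed.

Section annihilator.
Variable g : pt R -> R.
Hypothesis ig : (leb3 R).-integrable Omega (EFin \o g).
Hypothesis g0 : forall phi, test_function Omega phi -> ips Omega g phi = 0.

(** Dominated convergence with majorant [|g|]: the cutoffs lie between 0 and 1 and tend pointwise to
    the indicator of the intersection of [Omega] and [cell L]. *)
Lemma annihilator_cell L : (\int[leb3 R]_(x in Omega `&` cell L) (g x)%:E)%E = 0%E.
Proof.
pose f_ N x := (g x * cutoff N.+1%:R (L0 ++ L) x)%:E.
pose f x := (g x * (x \in cell (L0 ++ L))%:R)%:E.
have mg : measurable_fun Omega g.
  by apply/measurable_EFinP; exact: (measurable_int (leb3 R)).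
have mf_ N : measurable_fun Omega (f_ N).
  apply/measurable_EFinP; apply: measurable_funM => //; apply: measurable_funTS.
  by apply: continuous_measurable_pt; apply: flatalg_continuous; exact: cutoff_flatalg.
have mf : measurable_fun Omega f.
  apply/measurable_EFinP; apply: measurable_funM => //; apply: measurable_funTS.
  have := @measurable_indic _ _ R setT _ (measurable_cell (L0 ++ L)).
  by rewrite /indic.
have fint N : (\int[leb3 R]_(x in Omega) f_ N x)%E = 0%E.
  (* A vanishing real integral could hide an infinite one, so integrability is needed to recover the
     extended-real identity. *)
  have := g0 (cutoff_test_function N L); rewrite /ips /Rintegral => E0.
  rewrite -[LHS]fineK ?E0//; apply: integrable_fin_num => //.
  apply: (le_integrable mO (mf_ N) _ ig) => x Ox; rewrite /f_ /= ?lee_fin normrM ler_piMr//.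
  by rewrite ger0_norm ?cutoff_ge0 ?cutoff_le1.
have [] := @dominated_convergence _ _ R (leb3 R) Omega mO f_ f (EFin \o (fun x => `|g x|)) mf_ mf.
- apply: aeW => x Ox; apply: cvg_EFin; first exact: nearW.
  by apply: cvgM; [exact: cvg_cst|exact: cutoff_cvg].
- have := integrable_norm ig; congr (_.-integrable _ _).
- apply: aeW => x N Ox; rewrite /= lee_fin normrM ler_piMr//.
  by rewrite ger0_norm ?cutoff_ge0 ?cutoff_le1.
move=> _ _; rewrite (_ : (fun N => _) = cst 0%E); last exact/funext.
move=> c0; have := cvg_unique _ c0 (cvg_cst _) => <- //.
rewrite integral_mkcondr; apply: eq_integral => x /[!inE] Ox.
rewrite /f /patch cell_cat in_setI (mem_set (Ox : cell L0 x))/=.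
by case: ifP => _; rewrite ?mulr1 ?mulr0.
Qed.

(** Half-spaces alone make the three coordinates measurable for the generated sigma-algebra, so the
    identity map into the product sigma-algebra is measurable. *)
Lemma measurable_cells : @measurable _ (mpt R) = <<s range (@cell R) >>.
Proof.
apply/seteqP; split; last first.
  by apply: smallest_sub; [exact: sigma_algebra_measurable|];
    move=> _ [L _ <-]; exact: measurable_cell.
pose T := g_sigma_algebraType (range (@cell R)).
have halfspace (a : pt R) : measurable_fun (setT : set T) (pdot a : T -> measurableTypeR R).
  apply: (measurability _ (RGenInftyO.measurableE R)) => _ [_ [y ->] <-].
  apply: sub_sigma_algebra; exists [:: (a, y)] => //.
  by apply/seteqP; split => x /=; rewrite /cell/= andbT in_itv/= ?setTI//; case.
have m1 : measurable_fun (setT : set T) (fun x : T => x.1.1 : measurableTypeR R).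
  have := halfspace (1, 0, 0); congr (measurable_fun _ _).
  by apply/funext => x; rewrite /pdot/= mul1r !mul0r !addr0.
have m2 : measurable_fun (setT : set T) (fun x : T => x.1.2 : measurableTypeR R).
  have := halfspace (0, 1, 0); congr (measurable_fun _ _).
  by apply/funext => x; rewrite /pdot/= mul1r !mul0r addr0 add0r.
have m3 : measurable_fun (setT : set T) (fun x : T => x.2 : measurableTypeR R).
  have := halfspace (0, 0, 1); congr (measurable_fun _ _).
  by apply/funext => x; rewrite /pdot/= mul1r !mul0r !add0r.
have mid := measurable_fun_pair (measurable_fun_pair m1 m2) m3.
move=> A mA; have := mid measurableT A mA; rewrite setTI.
by rewrite (_ : _ @^-1` A = A)//; apply/seteqP; split => -[[x1 x2] x3].
Qed.

(** Dynkin's pi-lambda argument; integrability of [g] justifies complements and countable disjoint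
    unions. *)
Lemma annihilator_measurable E : measurable (E : set (mpt R)) ->
  (\int[leb3 R]_(x in Omega `&` E) (g x)%:E)%E = 0%E.
Proof.
have mg : measurable_fun Omega (EFin \o g) by exact: measurable_int ig.
have OT : (\int[leb3 R]_(x in Omega `&` setT) (g x)%:E)%E = 0%E.
  rewrite (_ : setT = cell [::]); first exact: annihilator_cell.
  by apply/seteqP; split.
rewrite {1}measurable_cells; apply: (@dynkin_induction _ (mpt R) (range (@cell R))
  (fun E => (\int[leb3 R]_(x in Omega `&` E) (g x)%:E)%E = 0%E)) => //.
- exact: measurable_cells.
- by move=> _ _ [L1 _ <-] [L2 _ <-]; exists (L1 ++ L2) => //; exact: cell_cat.
- by move=> _ [L _ <-]; exact: annihilator_cell.
- move=> S mS S0; move: OT; rewrite -(setvU S) setIUr integral_setU//=.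
  + by rewrite S0 adde0.
  + by apply: measurableI => //; exact: measurableC.
  + exact: measurableI.
  + by rewrite -setIUr setvU setIT.
  + by apply/disj_setPS => x [[_ ?] [_ ?]].
- move=> F mF tF F0; rewrite setI_bigcupr integral_bigcup.
  + by rewrite eseries0.
  + exact: trivIset_setIl.
  + by move=> n; exact: measurableI.
  + apply: integrableS ig => //; last by rewrite -setI_bigcupr; exact: subIsetl.
    by apply: bigcupT_measurable => n; exact: measurableI.
Qed.

Lemma annihilator_ae0 : ae_eq (leb3 R) Omega (EFin \o g) (cst 0%E).
Proof.
apply: integral_ae_eq => // E EO mE.
by rewrite integral0 -[in LHS](setIidr EO) annihilator_measurable.
Qed.

Lemma annihilator_nrms0 : nrms Omega g = 0.
Proof.
rewrite /nrms (_ : ips _ _ _ = 0) ?sqrtr0// /ips /Rintegral.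
rewrite (ae_eq_integral (cst 0%E))//.
- by rewrite integral0.
- have mg : measurable_fun Omega g.
    by apply/measurable_EFinP; exact: (measurable_int (leb3 R)).
  by apply/measurable_EFinP; exact: measurable_funM.
- move: annihilator_ae0; apply: filterS => x /[apply] /= [[->]].
  by rewrite mulr0.
Qed.

End annihilator.

Lemma H10_cst0 : H10 Omega (fun=> 0).
Proof.
have fO := leb3_lty bO mO.
have L20 : L2 Omega (fun=> 0).
  by apply: (@L2_bounded _ _ mO fO _ 0) => // x _; rewrite normr0.
have ips0l f : ips Omega (fun=> 0) f = 0.
  rewrite /ips; under eq_Rintegral do rewrite mul0r.
  by rewrite Rintegral_cst// mul0r.
have H1_0 : H1 Omega (fun=> 0).
  split => // j; exists (fun=> 0); split => // phi _.
  by rewrite !ips0l oppr0.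
have sq0 (f : pt R -> R) : (forall x, f x = 0) -> nrms Omega f = 0.
  move=> f0; rewrite /nrms (_ : f = fun=> 0) ?ips0l ?sqrtr0//.
  exact/funext.
split => //; exists (fun _ _ => 0); split.
- move=> _; have sm : smooth (fun _ : pt R => 0 : R) by exact/flatalg_smooth/flatalg_cst.
  have E : [set x : pt R | (0 : R) != 0] = set0 by apply/seteqP; split => x; rewrite /= eqxx.
  by split; rewrite // E closure0//; exact: compact0.
- rewrite (_ : (fun n => _) = cst 0); first exact: cvg_cst.
  by apply/funext => n; apply: sq0 => x; rewrite /= subr0.
- move=> j; rewrite (_ : (fun n => _) = cst 0); first exact: cvg_cst.
  apply/funext => n.
  have [Lw ww] := wpartialP j H1_0.
  (* The chosen weak derivative of 0 may be any representative; it annihilates all test functions,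
     so its norm is 0. *)
  rewrite -[RHS](@annihilator_nrms0 (wpartial Omega j (fun=> 0))).
  + rewrite /nrms; congr Num.sqrt; apply: eq_Rintegral => x _ /=.
    by rewrite derive_cst sub0r mulrNN.
  + exact: L2_integrable.
  + move=> phi tphi; apply: oppr_inj; rewrite -(ww phi tphi) oppr0.
    exact: ips0l.
Qed.

End fundamental_lemma.

(** * Increments in time *)

(** Cauchy-Schwarz in time, obtained from the nonnegative integral of [(u' t - m) ^+ 2], where [m]
    is the mean of [u'] on the interval. *)
Lemma sqr_increment_le (R : realType) (u u' : R -> R) (a b : R) : a < b ->
  (forall t : R, is_derive t 1 u (u' t)) -> continuous u' ->
  (u b - u a) ^+ 2 <= (b - a) * (\int[lebesgue_measure]_(t in `[a, b]) (u' t ^+ 2))%R.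
Proof.
move=> ab du cu'.
have int (f : R -> R) : continuous f -> lebesgue_measure.-integrable `[a, b] (EFin \o f).
  move=> cf; apply: continuous_compact_integrable; first exact: segment_compact.
  exact: continuous_subspaceT.
have cu : continuous u.
  by move=> t; apply/differentiable_continuous/derivable1_diffP; have [] := du t.
have ftc : (\int[lebesgue_measure]_(t in `[a, b]) (u' t))%R = u b - u a.
  rewrite /Rintegral (@continuous_FTC2 _ u' u a b ab) //.
  - exact: continuous_subspaceT.
  - split.
    + by move=> t _; have [] := du t.
    + by apply: cvg_at_right_filter; exact: cu.
    + by apply: cvg_at_left_filter; exact: cu.
  - by move=> t _; rewrite derive1E; have [] := du t.
set I := (X in _ * X); set d := u b - u a in ftc *.
have ba : 0 < b - a by rewrite subr_gt0.
pose m := d / (b - a).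
have csq : continuous (fun t => u' t ^+ 2) by move=> t; apply: cvgM; exact: cu'.
have := @Rintegral_ge0 _ _ _ lebesgue_measure `[a, b]%classic (fun t => (u' t - m) ^+ 2)
   (fun _ _ => sqr_ge0 _).
have -> : (\int[lebesgue_measure]_(t in `[a, b]) ((u' t - m) ^+ 2))%R =
    I + - 2 * m * d + m ^+ 2 * (b - a).
  transitivity (\int[lebesgue_measure]_(t in `[a, b])
     (u' t ^+ 2 + - 2 * m * u' t + m ^+ 2))%R.
    by apply: eq_Rintegral => t _; ring.
  have c1 : continuous (fun t => - 2 * m * u' t).
    by move=> t; apply: cvgM; [exact: cvg_cst|exact: cu'].
  rewrite RintegralD//; first last.
  - by apply: int => t; exact: cvg_cst.
  - by apply: int => t; apply: cvgD; [exact: csq|exact: c1].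
  rewrite RintegralD//; [|exact: int|exact: int].
  rewrite RintegralZl//; last exact: int.
  have L : fine (lebesgue_measure `[a, b]%classic) = b - a.
    by rewrite lebesgue_measure_itv/= lte_fin ab.
  by rewrite ftc -L; congr (_ + _); apply: Rintegral_cst.
rewrite -(pmulr_rge0 _ ba) => H.
rewrite -subr_ge0; apply: le_trans H _.
rewrite (_ : (b - a) * (I + - 2 * m * d + m ^+ 2 * (b - a)) = (b - a) * I - d ^+ 2)//.
by rewrite /m; field; rewrite gt_eqF.
Qed.

Lemma continuous_sum (R : realType) (T : topologicalType) (I : Type) (r : seq I)
    (h : I -> T -> R) :
  (forall i, continuous (h i)) -> continuous (fun z => \sum_(i <- r) h i z).
Proof.
move=> ch; elim: r => [|i r IH] z.
  by under eq_fun do rewrite big_nil; exact: cvg_cst.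
by under eq_fun do rewrite big_cons; apply: cvgD; [exact: ch|exact: IH].
Qed.

Lemma leb3_sigma_finiteT (R : realType) : sigma_finite setT (leb3 R).
Proof.
exists (fun n => cube n%:R).
  apply/seteqP; split => // -[[x1 x2] x3] _.
  pose m := `|x1| + `|x2| + `|x3|.
  have m0 : 0 <= m by rewrite !addr_ge0.
  exists (Num.bound m) => //.
  have H y : `|y| <= m -> `[- (Num.bound m)%:R, (Num.bound m)%:R]%classic y.
    by move=> ym; rewrite /= in_itv/= -ler_norml (le_trans ym)// ltW// archi_boundP.
  by split; [split|]; apply: H; rewrite /m ?lerDr ?addr_ge0// -?addrA ?lerDl ?addr_ge0//
    addrCA lerDl addr_ge0.
move=> n; split; last exact: leb3_cube_lty.
by apply: measurableX => //; exact: measurableX.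
Qed.

(** The same measure carrying the sigma-finite structure that Tonelli's theorem demands. *)
Definition leb3_sigma_finite (R : realType) : {sigma_finite_measure set (mpt R) -> \bar R} :=
  HB.pack_for {sigma_finite_measure set (mpt R) -> \bar R} (Measure.sort (leb3 R))
    (@Measure_isSigmaFinite.Build _ _ _ (leb3 R) (@leb3_sigma_finiteT R)).

(** * The increment of the applied field bounded by its time derivative *)

Section space_time.
Context {R : realType} (Omega : set (pt R)).
Hypothesis bO : bounded_set Omega.
Hypothesis mO : measurable (Omega : set (mpt R)).

Let fO : (leb3 R Omega < +oo)%E := leb3_lty bO mO.

Lemma L2_ext (f g : pt R -> R) : (forall x, Omega x -> f x = g x) -> L2 Omega g -> L2 Omega f.
Proof.
move=> fg; rewrite /L2/= (_ : f \_ Omega = g \_ Omega)//.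
by apply/funext => x; rewrite /patch; case: ifPn => // /[!inE] /fg.
Qed.

Lemma continuous_bounded_on (T : topologicalType) (K : set T) (f : T -> R) :
  compact K -> continuous f -> exists2 M, 0 <= M & forall x, K x -> `|f x| <= M.
Proof.
move=> cK cf.
have [M [_ HM]] : bounded_set (f @` K).
  apply: compact_bounded; apply: continuous_compact => //.
  exact/continuous_subspaceT.
exists (Num.max (M + 1) 0); first by rewrite le_max lexx orbT.
move=> x Kx; have MM : M < M + 1 by rewrite ltrDl.
by rewrite le_max (HM _ MM)//; exists x.
Qed.

Lemma continuous_L2 (f : pt R -> R) : continuous f -> L2 Omega f.
Proof.
move=> cf; have [M M0 HM] := continuous_bounded_on (closure_compact bO) cf.
apply: (@L2_bounded _ _ mO fO _ M).
  by apply: measurable_funTS; apply: continuous_measurable_pt.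
by move=> x Ox; apply: HM; exact: subset_closure.
Qed.

Lemma continuous_slice (g : pt R * R -> R) t : continuous g -> continuous (fun x => g (x, t)).
Proof.
move=> cg x; apply: (@continuous_comp _ _ _ (fun x : pt R => (x, t)) g); last exact: cg.
move=> U [[/= A B] [/= nA nB] sub]; apply: filterS nA => y Ay.
by apply: sub; split => //=; exact: nbhs_singleton nB.
Qed.

Lemma continuous_fiber (g : pt R * R -> R) x : continuous g -> continuous (fun t : R => g (x, t)).
Proof.
move=> cg t; apply: (@continuous_comp _ _ _ (fun t : R => (x, t)) g); last exact: cg.
move=> U [[/= A B] [/= nA nB] sub]; apply: filterS nB => y By.
by apply: sub; split => //=; exact: nbhs_singleton nA.
Qed.

Variables (tF : R) (ha : R -> pt R -> 'rV[R]_3).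
Hypothesis sha : smooth_field Omega tF ha.

Lemma smooth_field_mL2 t : `[0, tF]%classic t -> mL2 Omega (ha t).
Proof.
move=> t0 i j; rewrite ord1; have [g [sg gE]] := sha j.
apply: (@L2_ext _ (fun x => g (x, t))).
  by move=> x Ox; apply: gE => //; exact: subset_closure.
by apply: continuous_L2; apply: continuous_slice; have [] := sg 0%N.
Qed.

Let et : pt R * R := (0, 1).

Lemma is_derive_time (g : pt R * R -> R) (x : pt R) (t : R) : smooth g ->
  is_derive t 1 (fun s : R => g (x, s)) ('D_et g (x, t)).
Proof.
move=> sg; have [_ /(_ et)[dg _]] := sg 1%N.
have E s : (s *: et + (x, 0)) = (x, s) :> pt R * R.
  rewrite /et; congr (_, _) => /=; first by rewrite scaler0 add0r.
  by rewrite addr0 [_ *: _]mulr1.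
have := @is_derive_line _ _ g (x, 0) et t ('D_et g (x, t)).
rewrite E => /(_ (derivableP (dg _))).
by under eq_fun do rewrite E.
Qed.

(** At each fixed [x] the one-dimensional bound applies to every component of the smooth extension;
    integration over [Omega] and Tonelli's theorem give the claim. *)
Lemma increment_le (a b : R) : 0 <= a -> a < b -> b <= tF ->
  nrm Omega (ha b - ha a) ^+ 2 <=
  (b - a) * (\int[lebesgue_measure]_(r in `[a, b]) (nrm Omega (dt ha r) ^+ 2))%R.
Proof.
move=> a0 ab btF.
have ba : 0 < b - a by rewrite subr_gt0.
have [g gP] := choice sha.
have sg i : smooth (g i) by have [] := gP i.
have gE i t x : `[0, tF]%classic t -> closure Omega x -> ha t x 0 i = g i (x, t).
  by have [_ +] := gP i; apply.
pose Q z := \sum_i ('D_et (g i) z) ^+ 2.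
have cg i : continuous ('D_et (g i)).
  by have [_ /(_ et)[_ []]] := sg i 1%N.
have cQ : continuous Q.
  by apply: continuous_sum => i z; apply: cvgM; exact: cg.
have Q0 z : 0 <= Q z by apply: sumr_ge0 => i _; exact: sqr_ge0.
have mQ := continuous_measurable_ptR cQ.
pose Om : set (mpt R) := Omega.
pose ab01 : set (measurableTypeR R) := `[a, b]%classic.
have [M M0 HM] := continuous_bounded_on
  (compact_setX (closure_compact bO) (@segment_compact R a b)) cQ.
pose D x := \sum_i (g i (x, b) - g i (x, a)) ^+ 2.
have D0 x : 0 <= D x by apply: sumr_ge0 => i _; exact: sqr_ge0.
(* Truncation by the indicator turns the integrals over [Omega] and over the time interval into
   integrals over whole spaces, the form needed for Tonelli's theorem. *)
pose f (z : mpt R * measurableTypeR R) : \bar R := (Q z * \1_(Om `*` ab01) z)%:E.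
have mOab : measurable (Om `*` ab01) by apply: measurableX => //; exact: measurable_itv.
have mf : measurable_fun setT f.
  by apply/measurable_EFinP; apply: measurable_funM => //; exact: measurable_indic.
have f0 z : (0 <= f z)%E by rewrite lee_fin mulr_ge0.
pose G (s : R) := (\int[leb3 R]_(x in Omega) (Q (x, s))%:E)%E.
have fub : (\int[leb3 R]_(x in Omega) \int[lebesgue_measure]_(s in `[a, b]) (Q (x, s))%:E =
    \int[lebesgue_measure]_(s in `[a, b]) G s)%E.
  have F := @fubini_tonelli _ _ (mpt R) (measurableTypeR R) R
    (leb3_sigma_finite R) lebesgue_measure f mf f0.
  rewrite [LHS]integral_mkcond [RHS]integral_mkcond.
  etransitivity; last (etransitivity; [exact: F|]).
    apply: eq_integral => x _; rewrite /patch; case: ifPn => xO.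
      rewrite [LHS]integral_mkcond; apply: eq_integral => s _.
      rewrite /f /patch indicE in_setX xO /=.
      by case: ifP => _; rewrite ?mulr1 ?mulr0.
    rewrite integral0_eq// => s _.
    by rewrite /f indicE in_setX (negbTE xO) mulr0.
  apply: eq_integral => s _; rewrite /patch; case: ifPn => sI.
    rewrite /G [RHS]integral_mkcond; apply: eq_integral => x _.
    rewrite /f /patch indicE in_setX sI andbT.
    by case: ifP => _; rewrite ?mulr1 ?mulr0.
  rewrite integral0_eq// => x _.
  by rewrite /f indicE in_setX (negbTE sI) andbF mulr0.
have Gs_ge0 s : (0 <= G s)%E by apply: integral_ge0 => x _; rewrite lee_fin.
have G_le s : `[a, b]%classic s -> (G s <= M%:E * leb3 R Omega)%E.
  move=> sI; rewrite -integral_cst//; apply: ge0_le_integral => //.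
  - by move=> x _; rewrite lee_fin.
  - apply/measurable_EFinP; apply: measurable_funTS; apply: continuous_measurable_pt.
    exact: continuous_slice.
  - move=> x Ox; rewrite lee_fin -[Q _]ger0_norm//; apply: HM; split => //.
    exact: subset_closure.
have G_fin s : `[a, b]%classic s -> G s \is a fin_num.
  move=> sI; rewrite ge0_fin_numE//; apply: le_lt_trans (G_le _ sI) _.
  by rewrite lte_mul_pinfty.
have mG : measurable_fun setT (G : measurableTypeR R -> \bar R).
  pose f1 (z : mpt R * measurableTypeR R) : \bar R := (Q z * \1_(Om `*` setT) z)%:E.
  have mf1 : measurable_fun setT f1.
    apply/measurable_EFinP; apply: measurable_funM => //; apply: measurable_indic.
    exact: measurableX.
  have f10 z : (0 <= f1 z)%E by rewrite lee_fin mulr_ge0.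
  have := @measurable_fun_fubini_tonelli_G _ _ (mpt R) (measurableTypeR R) R
    (leb3_sigma_finite R) f1 mf1 f10.
  congr (measurable_fun _ _); apply/funext => s; rewrite /fubini_G /G [RHS]integral_mkcond.
  apply: eq_integral => x _; rewrite /f1 /patch indicE in_setX in_setT andbT.
  by case: ifP => _; rewrite ?mulr1 ?mulr0.
(* The field agrees with its extension only for times in [[0, tF]], so the time derivatives are
   compared at interior times, where agreement holds in a neighbourhood. The endpoints have measure
   zero and are dropped in [IE]. *)
have nrmG s : s \in `]a, b[ -> (nrm Omega (dt ha s) ^+ 2)%:E = G s.
  rewrite in_itv/= => /andP[sa sb].
  have sI : `[a, b]%classic s by rewrite /= in_itv/= !ltW.
  rewrite nrm_sqr -[RHS]fineK ?G_fin//; congr (_%:E).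
  transitivity (\int[leb3 R]_(x in Omega) Q (x, s))%R; last by [].
  apply: eq_Rintegral => x /[!inE] Ox; rewrite /Defs.dotmx big_ord1.
  apply: eq_bigr => i _; rewrite -expr2; congr (_ ^+ 2).
  rewrite /dt mxE derive1E.
  have [_ <-] := is_derive_time x s (sg i).
  apply: near_eq_derive; near=> r.
  apply: gE; last exact: subset_closure.
  rewrite /= in_itv/=; apply/andP; split.
    apply: (le_trans a0); apply: ltW; near: r.
    by apply: open_nbhs_nbhs; split => //; exact: open_gt.
  apply: le_trans _ btF; apply: ltW; near: r.
  by apply: open_nbhs_nbhs; split => //; exact: open_lt.
have IE : (\int[lebesgue_measure]_(r in `[a, b]) (nrm Omega (dt ha r) ^+ 2)%:E =
    \int[lebesgue_measure]_(r in `[a, b]) G r)%E.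
  have E1 : (\int[lebesgue_measure]_(r in `]a, b[) (nrm Omega (dt ha r) ^+ 2)%:E =
    \int[lebesgue_measure]_(r in `]a, b[) G r)%E.
    by apply: eq_integral => s /[!inE] sI; exact: nrmG.
  have mG1 : measurable_fun `]a, b[%classic (G : measurableTypeR R -> \bar R).
    exact: measurable_funTS.
  rewrite integral_itv_bndoo ?E1; last first.
    by apply: eq_measurable_fun mG1 => s /[!inE] sI; exact/esym/nrmG.
  by rewrite integral_itv_bndoo.
have IG : (\int[lebesgue_measure]_(r in `[a, b]) G r \is a fin_num)%E.
  rewrite ge0_fin_numE ?integral_ge0//.
  apply: (@le_lt_trans _ _ (\int[lebesgue_measure]_(r in `[a, b]) (M%:E * leb3 R Omega))%E).
    by apply: ge0_le_integral => //; exact: measurable_funTS.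
  rewrite (_ : (M%:E * _)%E = (M * fine (leb3 R Omega))%:E); last first.
    by rewrite EFinM fineK// ge0_fin_numE.
  have L : lebesgue_measure `[a, b]%classic = (b - a)%:E.
    by rewrite lebesgue_measure_itv/= lte_fin ab.
  rewrite (_ : (\int[_]_(_ in _) _)%E = ((M * fine (leb3 R Omega)) * (b - a))%:E) ?ltry//.
  by rewrite [RHS]EFinM -L integral_cst.
have cD : continuous D.
  apply: continuous_sum => i z.
  have c1 : continuous (fun x => g i (x, b) - g i (x, a)).
    by move=> x; apply: cvgB; apply: continuous_slice; have [] := sg i 0%N.
  by apply: cvgM; exact: c1.
have lhsE : nrm Omega (ha b - ha a) ^+ 2 = fine (\int[leb3 R]_(x in Omega) (D x)%:E).
  rewrite nrm_sqr; apply: eq_Rintegral => x /[!inE] Ox; rewrite /Defs.dotmx big_ord1.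
  have Cx : closure Omega x by exact: subset_closure.
  apply: eq_bigr => i _; rewrite -expr2 fctE !mxE (gE _ b)// ?(gE _ a)//.
  - by rewrite /= in_itv/= a0 (le_trans (ltW ab)).
  - by rewrite /= in_itv/= (le_trans a0 (ltW ab)).
have iQ x : lebesgue_measure.-integrable `[a, b] (EFin \o (fun s => Q (x, s))).
  apply: continuous_compact_integrable; first exact: segment_compact.
  by apply: continuous_subspaceT; exact: continuous_fiber.
have DQ x : ((D x)%:E <= (b - a)%:E * \int[lebesgue_measure]_(s in `[a, b]) (Q (x, s))%:E)%E.
  rewrite -[X in (_ * X)%E]fineK; last first.
    by apply: integrable_fin_num => //; exact: iQ.
  rewrite -EFinM lee_fin -/(Rintegral _ _ _).
  have ci i : continuous (fun s : R => 'D_et (g i) (x, s)) :=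
    @continuous_fiber ('D_et (g i)) x (@cg i).
  have csq i : lebesgue_measure.-integrable `[a, b] (EFin \o (fun s => 'D_et (g i) (x, s) ^+ 2)).
    apply: continuous_compact_integrable; first exact: segment_compact.
    by apply: continuous_subspaceT => s; apply: cvgM; exact: ci.
  rewrite (Rintegral_sum _ _ csq).2// mulr_sumr; apply: ler_sum => i _.
  exact: (@sqr_increment_le R (fun t => g i (x, t)) (fun t => 'D_et (g i) (x, t)) a b ab
    (fun t => is_derive_time x t (sg i)) (@ci i)).
have mF : measurable_fun setT (fun x : mpt R =>
    \int[lebesgue_measure]_(s in `[a, b]) (Q (x, s))%:E)%E.
  pose f1 (z : mpt R * measurableTypeR R) : \bar R := (Q z * \1_(setT `*` ab01) z)%:E.
  have mf1 : measurable_fun setT f1.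
    apply/measurable_EFinP; apply: measurable_funM => //; apply: measurable_indic.
    by apply: measurableX => //; exact: measurable_itv.
  have f10 z : (0 <= f1 z)%E by rewrite lee_fin mulr_ge0.
  have := @measurable_fun_fubini_tonelli_F _ _ (mpt R) (measurableTypeR R) R
    lebesgue_measure f1 mf1 f10.
  congr (measurable_fun _ _); apply/funext => x; rewrite /fubini_F [RHS]integral_mkcond.
  apply: eq_integral => s _; rewrite /f1 /patch indicE in_setX in_setT/=.
  by case: ifP => _; rewrite ?mulr1 ?mulr0.
have le_DG : (\int[leb3 R]_(x in Omega) (D x)%:E <=
    (b - a)%:E * \int[lebesgue_measure]_(r in `[a, b]) G r)%E.
  rewrite -fub -ge0_integralZl//; first last.
  - by rewrite lee_fin ltW.
  - by move=> x _; apply: integral_ge0 => s _; rewrite lee_fin.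
  - exact: measurable_funTS.
  apply: ge0_le_integral => //.
  - by move=> x _; rewrite lee_fin.
  - by apply/measurable_EFinP; apply: measurable_funTS; exact: continuous_measurable_pt.
  - by apply: measurable_funeM; exact: measurable_funTS.
rewrite lhsE /Rintegral IE -lee_fin EFinM [X in (_ <= _ * X)%E]fineK// fineK//.
rewrite ge0_fin_numE; last by apply: integral_ge0 => x _; rewrite lee_fin.
apply: le_lt_trans le_DG _.
by rewrite -[X in (_ * X)%E]fineK// -EFinM ltry.
Unshelve. all: by end_near. Qed.

End space_time.

(** * The energy inequality *)

Lemma sum3 (V : nmodType) (F : 'I_3 -> V) : \sum_j F j = F 0 + F 1 + F 2%:R.
Proof.
rewrite !big_ord_recl big_ord0 addr0 addrA.
by congr (F _ + F _ + F _); apply/val_inj.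
Qed.

Lemma I3E : (((0 + 1)%R = 1%R :> 'I_3) * ((1 + 1)%R = 2%:R%R :> 'I_3)
  * ((2%:R + 1)%R = 0%R :> 'I_3) * ((0 + 2%:R)%R = 2%:R%R :> 'I_3)
  * ((1 + 2%:R)%R = 0%R :> 'I_3) * ((2%:R + 2%:R)%R = 1%R :> 'I_3))%type.
Proof. by do ![split]; apply/val_inj. Qed.

(** Algebraic core of the symmetry of curl: [a i j k] stands for the product of [d_j w_i] with
    [u_k], [b i j k] for that of [d_j u_i] with [w_k], and the hypothesis is integration by
    parts. *)
Lemma curl_sum (R : comRingType) (a b : 'I_3 -> 'I_3 -> 'I_3 -> R) :
  (forall i j k, b i j k = - a k j i) ->
  \sum_j (a (j + 2%:R) (j + 1) j - a (j + 1) (j + 2%:R) j) =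
  \sum_j (b (j + 2%:R) (j + 1) j - b (j + 1) (j + 2%:R) j).
Proof.
move=> ab; rewrite !sum3 !I3E !ab.
move: (a 0 1 2%:R) (a 0 2%:R 1) (a 1 0 2%:R) (a 1 2%:R 0) (a 2%:R 0 1) (a 2%:R 1 0).
by move=> *; ring.
Qed.

(** Here [n i j] stands for [|d_j u_i|^2] and [d i j] for the product of [d_i u_i] and [d_j u_j].
    The two groups on the right are [|curl u|^2], with its mixed terms already rewritten through
    [d], and [|div u|^2]. *)
Lemma curl_div_sum (R : comRingType) (n d : 'I_3 -> 'I_3 -> R) :
  (forall i j, d i j = d j i) ->
  \sum_i \sum_j n i j =
  \sum_j (n (j + 2%:R) (j + 1) + n (j + 1) (j + 2%:R) - 2 * d (j + 2%:R) (j + 1)) +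
  (n 0 0 + n 1 1 + n 2%:R 2%:R + 2 * d 0 1 + 2 * d 0 2%:R + 2 * d 1 2%:R).
Proof.
move=> dC; rewrite !sum3 !I3E (dC 1 0) (dC 2%:R 1).
move: (d 0 1) (d 1 2%:R) (d 0 2%:R) (n 0 0) (n 0 1) (n 0 2%:R) (n 1 0) (n 1 1) (n 1 2%:R)
  (n 2%:R 0) (n 2%:R 1) (n 2%:R 2%:R).
by move=> *; ring.
Qed.

(** * Curl, divergence and norm identities for fields in H^1_0 *)

Section vector_calculus.
Context {R : realType} (Omega : set (pt R)).
Hypothesis bO : bounded_set Omega.
Hypothesis mO : measurable (Omega : set (mpt R)).
Implicit Types u v w : pt R -> 'rV[R]_3.

Let wp u i j := wpartial Omega j (vcomp u i).

Lemma vL2_mL2 u : vL2 Omega u -> mL2 Omega u.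
Proof. by move=> Lu i j; rewrite ord1; exact: Lu. Qed.

Lemma vH10_mL2 u : vH10 Omega u -> mL2 Omega u.
Proof. by move=> Hu; apply: vL2_mL2 => i; exact/H10_L2/Hu. Qed.

Let wpL2 u i j : vH10 Omega u -> L2 Omega (wp u i j).
Proof. by move=> Hu; exact: H10_wpartial_L2 (Hu i). Qed.

Lemma vH10_grad_mL2 u : vH10 Omega u -> mL2 Omega (grad Omega u).
Proof.
move=> Hu i j; have := wpL2 i j Hu.
by congr (L2 _ _); apply/funext => x; rewrite mxE.
Qed.

Let curlE u j : (fun x => curl Omega u x 0 j) = wp u (j + 2%:R) (j + 1) \- wp u (j + 1) (j + 2%:R).
Proof. by apply/funext => x; rewrite !mxE. Qed.

Let divE u : div Omega u = wp u 0 0 \+ wp u 1 1 \+ wp u 2%:R 2%:R.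
Proof. by apply/funext => x; rewrite /div /mxtrace sum3 !mxE. Qed.

Lemma vH10_curl_mL2 u : vH10 Omega u -> mL2 Omega (curl Omega u).
Proof. by move=> Hu i j; rewrite ord1 curlE; apply: L2B; exact: wpL2. Qed.

Lemma ip_rV u v : mL2 Omega u -> mL2 Omega v ->
  ip Omega u v = \sum_j ips Omega (vcomp u j) (vcomp v j).
Proof. by move=> Lu Lv; rewrite ip_sum// big_ord1. Qed.

Lemma ip_curl u w : vH10 Omega u -> vH10 Omega w ->
  ip Omega (curl Omega w) u = ip Omega (curl Omega u) w.
Proof.
move=> Hu Hw; have Lu := vH10_mL2 Hu; have Lw := vH10_mL2 Hw.
have E v v' : vH10 Omega v -> vH10 Omega v' ->
    ip Omega (curl Omega v) v' =
    \sum_j (ips Omega (wp v (j + 2%:R) (j + 1)) (vcomp v' j) -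
            ips Omega (wp v (j + 1) (j + 2%:R)) (vcomp v' j)).
  move=> Hv Hv'; rewrite ip_rV//; [|exact: vH10_curl_mL2|exact: vH10_mL2].
  apply: eq_bigr => j _; rewrite /vcomp curlE ipsBl//; try exact: wpL2.
  exact: H10_L2 (Hv' j).
rewrite !E//.
apply: (@curl_sum _ (fun i j k => ips Omega (wp w i j) (vcomp u k))
  (fun i j k => ips Omega (wp u i j) (vcomp w k))) => i j k.
by rewrite (H10_ibp bO mO j (Hu i).1 (Hw k)) ipsC.
Qed.

Lemma ips_sub_sqr f g : L2 Omega f -> L2 Omega g ->
  ips Omega (f \- g) (f \- g) = ips Omega f f + ips Omega g g - 2 * ips Omega f g.
Proof.
move=> Lf Lg; have Ld := L2B Lf Lg.
by rewrite ipsBl// !ipsBr// [ips _ g f]ipsC; ring.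
Qed.

Lemma ips_add3_sqr f g e : L2 Omega f -> L2 Omega g -> L2 Omega e ->
  ips Omega (f \+ g \+ e) (f \+ g \+ e) = ips Omega f f + ips Omega g g + ips Omega e e
    + 2 * ips Omega f g + 2 * ips Omega f e + 2 * ips Omega g e.
Proof.
move=> Lf Lg Le; have Lfg := L2D Lf Lg; have Lfge := L2D Lfg Le.
rewrite !ipsDl// ![ips _ _ (_ \+ _)]ipsC !ipsDl//.
by rewrite [ips _ g f]ipsC [ips _ e f]ipsC [ips _ e g]ipsC; ring.
Qed.

Lemma ip_grad_curl_div u : vH10 Omega u ->
  ip Omega (grad Omega u) (grad Omega u) =
  ip Omega (curl Omega u) (curl Omega u) + ips Omega (div Omega u) (div Omega u).
Proof.
move=> Hu; have Lg i j := wpL2 i j Hu.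
rewrite ip_sum; [|exact: mO|exact: vH10_grad_mL2|exact: vH10_grad_mL2].
have -> : \sum_i \sum_j ips Omega (fun x => grad Omega u x i j) (fun x => grad Omega u x i j) =
    \sum_i \sum_j ips Omega (wp u i j) (wp u i j).
  apply: eq_bigr => i _; apply: eq_bigr => j _.
  rewrite (_ : (fun x => _) = wp u i j)//.
  by apply/funext => x; rewrite mxE.
rewrite ip_rV; [|exact: vH10_curl_mL2|exact: vH10_curl_mL2].
rewrite divE ips_add3_sqr; [|exact: Lg|exact: Lg|exact: Lg].
apply: etrans (@curl_div_sum _ (fun i j => ips Omega (wp u i j) (wp u i j))
  (fun i j => ips Omega (wp u i i) (wp u j j)) _) _; first by move=> i j; exact: ipsC.
congr (_ + _); apply: eq_bigr => j _; rewrite /vcomp curlE ips_sub_sqr; [|exact: Lg|exact: Lg].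
(* Exchanging the two directions of differentiation turns the mixed term of [|curl u|^2] into a
   product of diagonal derivatives, which the cross terms of [|div u|^2] cancel. *)
have swap : ips Omega (wp u (j + 2%:R) (j + 1)) (wp u (j + 1) (j + 2%:R)) =
    ips Omega (wp u (j + 2%:R) (j + 2%:R)) (wp u (j + 1) (j + 1)).
  exact: (H10_swap bO mO (j + 1) (j + 2%:R) (Hu (j + 2%:R)).1 (Hu (j + 1))).
exact: (esym (congr1 (fun r => ips Omega (wp u (j + 2%:R) (j + 1)) (wp u (j + 2%:R) (j + 1)) +
  ips Omega (wp u (j + 1) (j + 2%:R)) (wp u (j + 1) (j + 2%:R)) - 2 * r) swap)).
Qed.

Lemma nrm_subl m n (F G : pt R -> 'M[R]_(m, n)) : mL2 Omega F -> mL2 Omega G ->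
  nrm Omega G ^+ 2 = nrm Omega F ^+ 2 + nrm Omega (F - G) ^+ 2 - 2 * ip Omega (F - G) F.
Proof.
move=> LF LG; have LB := mL2B LF LG; rewrite !nrm_sqr.
rewrite [ip _ (F - G) (F - G)]ipBl// ![ip _ _ (F - G)]ipC !ipBl// [ip _ F G]ipC; ring.
Qed.

Lemma nrm_combination m n (F G : pt R -> 'M[R]_(m, n)) a : mL2 Omega F -> mL2 Omega G ->
  nrm Omega (F - a *: G) ^+ 2 = nrm Omega F ^+ 2 - 2 * a * ip Omega F G + a ^+ 2 * nrm Omega G ^+ 2.
Proof.
move=> LF LG; have LZ := mL2Z a LG; have LB := mL2B LF LZ; rewrite !nrm_sqr.
rewrite ipBl// ![ip _ _ (F - a *: G)]ipC !ipBl// !ipZl// [ip _ F (a *: G)]ipC !ipZl//.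
rewrite [ip _ G (a *: G)]ipC !ipZl// [ip _ G F]ipC.
by move: (ip _ F F) (ip _ F G) (ip _ G G) => *; ring.
Qed.

Lemma nrm_young m n (F G : pt R -> 'M[R]_(m, n)) a : mL2 Omega F -> mL2 Omega G ->
  2 * a * ip Omega F G <= a ^+ 2 * nrm Omega F ^+ 2 + nrm Omega G ^+ 2.
Proof.
move=> LF LG; have := sqr_ge0 (nrm Omega (G - a *: F)).
rewrite nrm_combination// [ip _ G F]ipC.
move: (nrm _ F ^+ 2) (nrm _ G ^+ 2) (ip _ F G) => f g b; lra.
Qed.

Lemma nrm_grad_curl_div u : vH10 Omega u ->
  nrm Omega (grad Omega u) ^+ 2 =
  nrm Omega (curl Omega u) ^+ 2 + nrms Omega (div Omega u) ^+ 2.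
Proof. by move=> Hu; rewrite !nrm_sqr nrms_sqr ip_grad_curl_div. Qed.

(** Stated for every [f], since the cross-product terms are not known to be integrable; infinite
    integrals become 0 on both sides. *)
Lemma Rintegral_opp (f : pt R -> R) :
  (\int[leb3 R]_(x in Omega) (- f x))%R = - (\int[leb3 R]_(x in Omega) f x)%R.
Proof.
rewrite /Rintegral; under eq_integral do rewrite EFinN.
rewrite [in LHS]integralE [in RHS]integralE funeposN funenegN.
set p := (\int[_]_(_ in _) _)%E; set q := (\int[_]_(_ in _) _)%E.
by case: p q => [p||] [q||] //=; rewrite ?opprB ?oppr0.
Qed.

Lemma dot_cross_self (m w : 'rV[R]_3) : Defs.dotmx (cross m w) m = 0.
Proof. rewrite /Defs.dotmx big_ord1 sum3 !mxE !I3E; ring. Qed.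

Lemma dot_cross_swap (m w h : 'rV[R]_3) :
  Defs.dotmx (cross m w) h = - Defs.dotmx (cross m h) w.
Proof. rewrite /Defs.dotmx !big_ord1 !sum3 !mxE !I3E; ring. Qed.

End vector_calculus.

(** The hypothesis [A 0] is essential information: the subspace holds only those representatives
    that lie in [A]. *)
Lemma fd_subspace_zero (R : realType) (Omega : set (pt R)) (V : lmodType R)
    (A S : set (pt R -> V)) : fd_subspace Omega A S -> A 0 -> S 0.
Proof.
move=> [n [e [_ ->]]] A0; split => //; exists (fun=> 0).
rewrite big1 ?/aeq//; first exact: ae_eq_refl.
by move=> i _; rewrite scale0r.
Qed.

(* With t = tau and all quantities at step k: [u w m h] are the squared norms of U, W, M, H, primes
   mark step k-1, [eu ew em eh] are the squared norms of the increments dX = X - X' and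
   [dU dW dM dH] the products (dX, X); [gU gW] are |grad|^2, [vU vW] |div|^2, [cU] is |curl U|^2,
   [z] is |curl U - 2 W|^2, [c] is (curl U, W), [B] is b_h^m(U, H, M), [X] is (M x H, W),
   [hm haH] are (M, H), (h_a, H), [a] is |h_a|^2, [q] is |d h_a|^2 and [I] the integral of
   |d_t h_a|^2.  The last row names the terms as they occur literally in the scheme. *)
Lemma energy_step (R : realFieldType) (nu nur mu j c1 c2 ka T t : R)
    (u w m h u' w' m' h' eu ew em eh dU dW dM dH : R)
    (gU gW cU vU vW z c B X hm haH dMH dhaH a q I : R)
    (a1 a2 a3 a4 b1 b2 b3 p1 x3 x4 gU1 gW1 vW1 w1 m1 h1 c' hm' hm'' haH' hh r5 r6 : R) :
  0 <= mu -> 0 <= ka -> 0 < T -> 0 < t ->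
  u' = u + eu - 2 * dU -> w' = w + ew - 2 * dW ->
  m' = m + em - 2 * dM -> h' = h + eh - 2 * dH ->
  b1 = 0 -> p1 = 0 -> a1 = t^-1 * dU -> gU = gU1 -> c' = c ->
  a1 + b1 + (nu + nur) * gU1 - p1 = 2 * nur * c' + mu * B ->
  b2 = 0 -> a2 = t^-1 * dW -> gW = gW1 -> vW = vW1 -> w = w1 ->
  j * a2 + j * b2 + c1 * gW1 + c2 * vW1 + 4 * nur * w1 = 2 * nur * c + mu * X ->
  b3 = 0 -> x3 = 0 -> a3 = t^-1 * dM -> m = m1 ->
  a3 - b3 + x3 + T^-1 * m1 = ka / T * hm ->
  x4 = - X -> a4 = t^-1 * dMH -> hm' = hm -> h = h1 ->
  a4 - B + x4 + T^-1 * hm' = ka / T * h1 ->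
  r5 = haH - hm' -> h1 = r5 -> r6 = haH' - hm'' -> hh = r6 ->
  dH = h1 - hh -> dhaH = haH - haH' -> dMH = hm' - hm'' ->
  gU = cU + vU -> z = cU - 2 * 2 * c + 2 ^+ 2 * w ->
  2 * 1 * haH <= 1 ^+ 2 * a + h ->
  2 * (2 * T / t) * dhaH <= (2 * T / t) ^+ 2 * q + h ->
  q <= t * I ->
  2^-1 * (u + j * w + mu * m + mu * h) + 2^-1 * (eu + j * ew + mu * em + mu * eh)
  + t * (nu * gU + c1 * gW + nur * vU + c2 * vW + nur * z + mu / T * m
         + mu / (2 * T) * (2^-1 + 3 * ka) * h)
  <= t * (T * mu / t * I + mu / (2 * T) * (1 + ka) * a)
     + 2^-1 * (u' + j * w' + mu * m' + mu * h').
Proof.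
move=> mu0 ka0 T0 t0 -> -> -> -> -> -> -> <- -> E1 -> -> <- <- <- E2 -> -> -> <- E3 -> -> -> <- E4.
move=> -> E5 -> -> E6 dhaE dME E7 -> Y1 Y2 Y3.
have tn : t != 0 by rewrite gt_eqF.
have Tn : T != 0 by rewrite gt_eqF.
have EU : dU = t * (2 * nur * c + mu * B - (nu + nur) * gU).
  by rewrite -E1; field.
have EW : j * dW = t * (2 * nur * c + mu * X - c1 * gW - c2 * vW - 4 * nur * w).
  by rewrite -E2; field.
have EM : dM = t * (ka / T * hm - T^-1 * m) by rewrite -E3; field; rewrite ?tn ?Tn.
have EB : B = t^-1 * dMH - X + T^-1 * hm - ka / T * h by rewrite -E4; field; rewrite ?tn ?Tn.
(* Testing leaves the coefficient [t * mu * (1 + 2 * ka) / T] on [h]. Young's inequality for [haH]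
   uses [t * mu * (1 + ka) / (2 * T)] of it and the one for [dhaH] uses [t * mu / (4 * T)]; the
   remainder is the coefficient in the dissipation. *)
have S1 : 0 <= t * mu * (1 + ka) / (2 * T) * (1 ^+ 2 * a + h - 2 * 1 * haH).
  by rewrite mulr_ge0 ?subr_ge0// divr_ge0 ?mulr_ge0 ?addr_ge0// ltW.
have S2 : 0 <= t * mu / (4 * T) * ((2 * T / t) ^+ 2 * q + h - 2 * (2 * T / t) * dhaH).
  by rewrite mulr_ge0 ?subr_ge0// divr_ge0 ?mulr_ge0// ltW.
have S3 : 0 <= mu * T * t^-1 * (t * I - q).
  by rewrite mulr_ge0 ?subr_ge0// !mulr_ge0 ?invr_ge0// ltW.
rewrite -subr_ge0.
apply: le_trans (addr_ge0 (addr_ge0 S1 S2) S3) _.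
(* The spin equation determines only the product [j * dW], and [j] may vanish, so this product is
   isolated before substituting. *)
have EW' : 2^-1 * (w + ew - 2 * dW) * j = 2^-1 * (w + ew) * j - j * dW by field.
(* The slack of the energy inequality is exactly the sum of the three nonnegative terms, so an
   identity remains to be checked. *)
rewrite le_eqVlt; apply/orP; left; apply/eqP.
rewrite [X in _ = _ + X - _](_ : _ = 2^-1 * (u + eu) - dU + (2^-1 * (w + ew) * j - j * dW)
   + mu * (2^-1 * (m + em) - dM) + mu * (2^-1 * (h + eh) - dH)); last by field.
have Ehm : hm = haH - h by rewrite E5; ring.
have EdH : dH = dhaH - dMH by rewrite E6 dhaE dME E5; ring.
(* Substituting [EB] cancels [B] and [X]. By [E7], part of the viscous term is [nur * cU], which
   together with [4 * nur * w] and the two couplings [2 * nur * c] forms [nur] times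
   [|curl U - 2 W|^2]. *)
rewrite EW EU EM EB E7 EdH Ehm.
by field; rewrite tn Tn.
Qed.

Lemma telescoping_le (R : realDomainType) (K : nat) (e i d f : nat -> R) :
  (forall k, (1 <= k <= K)%N -> e k + i k + d k <= f k + e k.-1) ->
  e K + \sum_(1 <= k < K.+1) i k + \sum_(1 <= k < K.+1) d k
  <= \sum_(1 <= k < K.+1) f k + e 0.
Proof.
elim: K => [|K IH] H; first by rewrite !big_geq// !addr0 add0r.
rewrite !(big_nat_recr K.+1)//=.
have := IH (fun k kK => H k (introT andP (conj (andP kK).1 (leqW (andP kK).2)))).
have := H K.+1 (leqnn _); rewrite /=; lra.
Qed.

(** * One time step of the scheme *)

Section main_step.
Context {R : realType} (Omega : set (pt R)) (c : material R) (tF : R)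
  (ha : R -> pt R -> 'rV[R]_3) (D : discretization R) (K : nat) (s : nat -> state R).
Hypothesis bO : bounded_set Omega.
Hypothesis mO : measurable (Omega : set (mpt R)).
Hypothesis H10_0 : H10 Omega (fun=> 0).
Hypothesis hc : admissible c.
Hypothesis htF : 0 < tF.
Hypothesis hha : smooth_field Omega tF ha.
Hypothesis hD : discrete_setting Omega D.
Hypothesis hgrad : forall chi, XX D chi -> MM D (sgrad Omega chi).
Hypothesis hbh : skew_in_last_two (UU D) (UW D) (bh D).
Hypothesis hbm : skew_in_last_two (UU D) (MM D) (bm D).
Hypothesis hK : (1 <= K)%N.
Hypothesis hs_sol : scheme_solution Omega c tF K ha D s.

Lemma vH10_0 : vH10 Omega 0.
Proof.
move=> i; rewrite (_ : vcomp 0 i = fun=> 0)//.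
by apply/funext => x; rewrite /vcomp mxE.
Qed.

Lemma skew_diag (A B : set (pt R -> 'rV[R]_3)) b u v :
  skew_in_last_two A B b -> A u -> B v -> b u v v = 0.
Proof.
move=> sk Au Bv; have := sk u v v Au Bv Bv; move: (b u v v) => y yE; lra.
Qed.

Lemma tau_gt0 : 0 < tau tF K.
Proof. by rewrite divr_gt0// ltr0n. Qed.

Lemma tk_itv k : (k <= K)%N -> `[0, tF]%classic (tk tF K k).
Proof.
move=> kK; rewrite /= in_itv/= /tk; apply/andP; split.
  by rewrite mulr_ge0// ltW// tau_gt0.
have K0 : 0 < K%:R :> R by rewrite ltr0n.
by rewrite /tau mulrA ler_pdivrMr// mulrC ler_wpM2l ?ler_nat// ltW.
Qed.

Lemma step_le k : (1 <= k <= K)%N ->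
  energy Omega c s k + increments Omega c s k + tau tF K * dissipation Omega c s k
  <= tau tF K * forcing Omega c tF K ha k + energy Omega c s k.-1.
Proof.
move=> /andP[k1 kK].
have k'K : (k.-1 <= K)%N by rewrite (leq_trans (leq_pred _)).
have [[[fU _ fW fM _] _ _] [sol0 sol1]] := (hD, hs_sol).
have [Uk Wk Mk Xk pk] := sol0 _ kK.
have [Uk' Wk' Mk' Xk' pk'] := sol0 _ k'K.
have [[Pk mom] inc spin mag] := sol1 k (introT andP (conj k1 kK)).
have sub (S : set (pt R -> 'rV[R]_3)) A v : fd_subspace Omega A S -> S v -> A v.
  by move=> [n [e [_ ->]]] [].
have HU := sub _ _ _ fU Uk; have HU' := sub _ _ _ fU Uk'.
have HW := sub _ _ _ fW Wk; have HW' := sub _ _ _ fW Wk'.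
have LU := vH10_mL2 HU; have LU' := vH10_mL2 HU'.
have LW := vH10_mL2 HW; have LW' := vH10_mL2 HW'.
have LM := vL2_mL2 (sub _ _ _ fM Mk); have LM' := vL2_mL2 (sub _ _ _ fM Mk').
have MH := hgrad Xk; have LH := vL2_mL2 (sub _ _ _ fM MH).
have LH' := vL2_mL2 (sub _ _ _ fM (hgrad Xk')).
have La := smooth_field_mL2 bO mO hha (tk_itv kK).
have La' := smooth_field_mL2 bO mO hha (tk_itv k'K).
have U0 := fd_subspace_zero fU vH10_0.
have W0 := fd_subspace_zero fW vH10_0.
have UWU : UW D (sU (s k)) by exists (sU (s k)) => //; exists 0 => //; rewrite addr0.
have UWW : UW D (sW (s k)) by exists 0 => //; exists (sW (s k)) => //; rewrite add0r.
have [[nu0_ nur0 mu0_ jm0] c10 c20 ka0 T0] := hc.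
have t0 := tau_gt0.
have LdU := mL2B LU LU'; have LdW := mL2B LW LW'; have LdM := mL2B LM LM'.
have LdH := mL2B LH LH'; have Lda := mL2B La La'.
pose H := sH Omega (s k); pose H' := sH Omega (s k.-1).
have X1 : ip Omega (fun x => cross (sM (s k) x) (sW (s k) x)) H =
          - ip Omega (fun x => cross (sM (s k) x) (H x)) (sW (s k)).
  rewrite -Rintegral_opp; apply: eq_Rintegral => x _; exact: dot_cross_swap.
have X0 : ip Omega (fun x => cross (sM (s k) x) (sW (s k) x)) (sM (s k)) = 0.
  rewrite /ip; under eq_Rintegral do rewrite dot_cross_self.
  by rewrite Rintegral_cst// mul0r.
rewrite /energy /increments /dissipation /forcing.
have E1 := mom _ Uk.
have E2 := spin _ Wk.
have E3 := mag _ Mk.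
have E4 := mag _ MH.
(* The Poisson equations at steps [k] and [k.-1] are tested with the same function, the potential at
   step [k]; for [k = 1] the second one is the equation defining the initial potential. *)
have E5 := pk _ Xk.
have E6 := pk' _ Xk.
have tkE : tk tF K k - tk tF K k.-1 = tau tF K.
  by rewrite /tk -mulrBl -natrB ?leq_pred// -{1}(prednK k1) subSnn mul1r.
have incr : nrm Omega (ha (tk tF K k) - ha (tk tF K k.-1)) ^+ 2 <= tau tF K *
    (\int[lebesgue_measure]_(r in `[tk tF K k.-1, tk tF K k]) (nrm Omega (dt ha r) ^+ 2))%R.
  rewrite -tkE; apply: (increment_le bO mO hha).
  - by have := tk_itv k'K; rewrite /= in_itv/= => /andP[].
  - by rewrite -subr_gt0 tkE.
  - by have := tk_itv kK; rewrite /= in_itv/= => /andP[].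
have Y1 := nrm_young mO 1 La LH.
(* After scaling by [tau * mu0 / (4 * TT)], this parameter gives the increment of the field the
   factor [TT * mu0 / tau] and leaves only a fraction of the dissipation of [H] to absorb. *)
have Y2 := nrm_young mO (2 * TT c / tau tF K) Lda LH.
have LcU : mL2 Omega (curl Omega (sU (s k))) by exact: vH10_curl_mL2.
have Z := nrm_combination mO 2 LcU LW.
have N := nrm_grad_curl_div bO mO HU.
have S := energy_step mu0_ ka0 T0 t0
  (nrm_subl mO LU LU') (nrm_subl mO LW LW') (nrm_subl mO LM LM') (nrm_subl mO LH LH')
  (skew_diag hbh Uk UWU) (inc _ Pk) (ipZl mO _ LdU LU) (nrm_sqr _ _) (ip_curl bO mO HU HW) E1
  (skew_diag hbh Uk UWW) (ipZl mO _ LdW LW) (nrm_sqr _ _) (nrms_sqr _ _) (nrm_sqr _ _) E2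
  (skew_diag hbm Uk Mk) X0 (ipZl mO _ LdM LM) (nrm_sqr _ _) E3
  X1 (ipZl mO _ LdM LH) (ipC _ _ _) (nrm_sqr _ _) E4
  (ipBl mO La LM LH) E5 (ipBl mO La' LM' LH) E6
  (ipBl mO LH LH' LH) (ipBl mO La La' LH) (ipBl mO LM LM' LH) N Z Y1 Y2 incr.
exact: S.
Qed.

End main_step.

Lemma convex_polyhedron_cell (R : realType) (Omega : set (pt R)) :
  convex_polyhedron Omega -> exists L, Omega = cell L.
Proof.
move=> [n [a [b [_ ->]]]]; exists [seq (a i, b i) | i <- enum 'I_n].
apply/seteqP; split => x /=.
  by move=> H; apply/allP => _ /mapP[i _ ->]; exact: H.
by move=> /allP H i; apply: (H (a i, b i)); apply/map_f; rewrite mem_enum.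
Qed.

Set Strict Implicit.
Unset Implicit Arguments.

Theorem proposition4p1 (R : realType) (Omega : set (pt R)) (c : material R)
  (tF : R) (ha : R -> pt R -> 'rV[R]_3)
  (hs : set R) (D : R -> discretization R)
  (hOmega : polyhedral_domain Omega) (hc : admissible c) (htF : 0 < tF)
  (hha : applied_field Omega tF ha)
  (hhs : forall h, hs h -> 0 < h)
  (hD : forall h, hs h -> discrete_setting Omega (D h))
  (hgrad : forall h, hs h -> forall chi, XX (D h) chi -> MM (D h) (sgrad Omega chi))
  (hLBB : LBB_stable Omega hs D)
  (hbh : forall h, hs h -> skew_in_last_two (UU (D h)) (UW (D h)) (bh (D h)))
  (hbm : forall h, hs h -> skew_in_last_two (UU (D h)) (MM (D h)) (bm (D h)))
  (h : R) (hh : hs h) (K : nat) (hK : (1 <= K)%N) (s : nat -> state R)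
  (hs_sol : scheme_solution Omega c tF K ha (D h) s) :
  energy Omega c s K
  + \sum_(1 <= k < K.+1) increments Omega c s k
  + \sum_(1 <= k < K.+1) tau tF K * dissipation Omega c s k
  <= \sum_(1 <= k < K.+1) tau tF K * forcing Omega c tF K ha k
     + energy Omega c s 0.
Proof.
have [_ bO _ /convex_polyhedron_cell[L OL]] := hOmega.
have mO : measurable (Omega : set (mpt R)) by rewrite OL; exact: measurable_cell.
have H0 : H10 Omega (fun=> 0) by move: bO; rewrite OL; exact: H10_cst0.
apply: (@telescoping_le _ K (energy Omega c s) (increments Omega c s)
  (fun k => tau tF K * dissipation Omega c s k)
  (fun k => tau tF K * forcing Omega c tF K ha k)) => k kK.
exact: (step_le bO mO H0 hc htF hha.1 (hD _ hh) (hgrad _ hh) (hbh _ hh) (hbm _ hh) hK hs_sol kK).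
Qed.
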